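(* Let $\mathcal{U}$ be a small category and $\mathcal{A}$ a quiver on $\mathcal{U}$. Then $\mathbf{C}_\square^{\bullet,\bullet,\bullet}(\mathcal{A})$ is a box operad with the following structure: (i) The composition maps $$\circ:\mathbf{C}_\square^{p,n,r}(\mathcal{A})\otimes\mathbf{C}_\square^{p_0,q_1,p_1}(\mathcal{A})\otimes\cdots\otimes\mathbf{C}_\square^{p_{n-1},q_n,p_n}(\mathcal{A})\longrightarrow\mathbf{C}_\square^{p+p_0,\sum_{i=1}^nq_i,r+p_n}(\mathcal{A})$$ are given, for a $(p+p_0)$-simplex $\sigma$ of $\mathcal{U}$ and $f\in\Delta^{inj}_f(r+p_n,p+p_0)$ with $f(r)=p$, by $$(\theta\circ(\theta_1,\dots,\theta_n))^{\sigma,f}:=\theta^{\sigma_{\le p},f_{\le r}}\circ(\theta_1\otimes_{\mathcal{A}}\cdots\otimes_{\mathcal{A}}\theta_n)^{\sigma_{>p},f_{>r}},$$ and the $(\sigma,f)$-component is zero if $f(r)\neq p$. (ii) The unit is the identity map $\mathrm{Id}\in\mathbf{C}_\square^{0,1,0}(\mathcal{A})$.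
   Context: $k$ is a commutative ring, $\mathbb{N}=\{0,1,2,\dots\}$. **Box operads.** A box operad $\mathcal{B}$ consists of $k$-modules $\mathcal{B}(p,q,r)$, $p,q,r\in\mathbb{N}$, composition maps $$\mu:\mathcal{B}(p,n,r)\otimes\bigotimes_{i=1}^n\mathcal{B}(p_{i-1},q_i,p_i)\to\mathcal{B}(p+p_0,\textstyle\sum_{i=1}^nq_i,r+p_n)$$ for all $n\ge 0$, $p,r,p_0,\dots,p_n,q_1,\dots,q_n\in\mathbb{N}$ (for $n=0$: a map $\mathcal{B}(p,0,r)\to\mathcal{B}(p+p_0,0,r+p_0)$ for each $p_0$) and a unit $\eta:k\to\mathcal{B}(0,1,0)$, such that $\mu(x;\mu(x_1;x^1_1,\dots,x^1_{m_1}),\dots,\mu(x_n;x^n_1,\dots,x^n_{m_n}))=\mu(\mu(x;x_1,\dots,x_n);x_1^1,\dots,x^n_{m_n})$ for $x,x_i,x^i_j$ of arities $(p,n,r)$, $(p_{i-1},m_i,p_i)$, $(p^i_{j-1},q^i_j,p^i_j)$ with $p^i_{m_i}=p^{i+1}_0$ for $0<i<n$ (if $m_i=0$, a number $p^i_0$ is still part of the data), and $\mu(x;1,\dots,1)=x=\mu(1;x)$. **Quivers.** A quiver $\mathcal{A}$ on $\mathcal{U}$ consists of: for each object $U$ of $\mathcal{U}$ a quiver $\mathcal{A}(U)$ (a set of objects $\mathrm{Ob}(\mathcal{A}(U))$ and $k$-modules of arrows $\mathcal{A}(U)(A,A')$), and for each morphism $u:V\to U$ a function $u^*:\mathrm{Ob}(\mathcal{A}(U))\to\mathrm{Ob}(\mathcal{A}(V))$.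 For a $p$-simplex $\sigma=(U_0\xrightarrow{u_1}U_1\to\cdots\xrightarrow{u_p}U_p)$ in $\mathcal{U}$, $\sigma^*:=u_1^*\circ\cdots\circ u_p^*:\mathrm{Ob}(\mathcal{A}(U_p))\to\mathrm{Ob}(\mathcal{A}(U_0))$ (identity if $p=0$). $\Delta_f^{inj}(r,p)$ is the set of strictly increasing maps $f:[r]\to[p]$, $[n]=\{0,\dots,n\}$, with $f(0)=0$ and $f(r)=p$; $f(\sigma)$ is the $r$-simplex $U_{f(0)}\to U_{f(1)}\to\cdots\to U_{f(r)}$ with composed arrows. **The modules.** For $p\ge r$, $$\mathbf{C}_\square^{p,q,r}(\mathcal{A}):=\prod_{\sigma,\ f\in\Delta^{inj}_f(r,p)}\ \prod_{A_0,\dots,A_q\in\mathcal{A}(U)}\mathrm{Hom}_k\Big(\bigotimes_{i=1}^q\mathcal{A}(U)(A_{i-1},A_i),\ \mathcal{A}(V)(\sigma^*A_0,f(\sigma)^*A_q)\Big),$$ where $\sigma$ ranges over $p$-simplices of $\mathcal{U}$ with first object $V$ and last object $U$; for $p<r$, $\mathbf{C}_\square^{p,q,r}(\mathcal{A}):=0$. Components are written $\theta^{\sigma,f}_{(A_0,\dots,A_q)}$. **Tensoring over $\mathcal{A}$.** For $\theta\in\mathbf{C}_\square^{p,q,r}(\mathcal{A})$ and $\theta'\in\mathbf{C}_\square^{r,q',t}(\mathcal{A})$, a $p$-simplex $\sigma$, $f\in\Delta^{inj}_f(t,p)$ and objects $A_0,\dots,A_{q+q'}$, $$(\theta\otimes_{\mathcal{A}}\theta')^{\sigma,f}_{(A_0,\dots,A_{q+q'})}:=\sum_{\substack{f_1\in\Delta^{inj}_f(r,p),\,f_2\in\Delta^{inj}_f(t,r)\\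 f=f_1\circ f_2}}\theta^{\sigma,f_1}_{(A_0,\dots,A_q)}\otimes\theta'^{\,f_1(\sigma),f_2}_{(A_q,\dots,A_{q+q'})},$$ and this is iterated for several factors (for $n=0$ factors the tensor is trivial). **Truncations.** $\sigma_{\le p}$ consists of the first $p$ arrows of $\sigma$ and $\sigma_{>p}$ of the remaining $p_0$ arrows; $f_{\le r}:[r]\to[p]$ is the restriction of $f$, and $f_{>r}:[p_n]\to[p_0]$ is $f_{>r}(j)=f(r+j)-p$. The symbol $\circ$ on the right-hand side in (i) is composition of the multilinear maps. *)

(* Defs.v *)
From HB Require Import structures.
From mathcomp Require Import all_boot all_algebra boolp.
From mathcomp Require Import zify.
From Stdlib Require Eqdep_dec PeanoNat.

Set Implicit Arguments.
Unset Strict Implicit.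
Unset Printing Implicit Defensive.

Import GRing.Theory.
Local Open Scope ring_scope.

(** Used both for the simplices of a category (strings of composable morphisms)
    and for the words a_1 (x) ... (x) a_q, with a_i an arrow from A_{i-1} to A_i,
    on which multilinear maps are evaluated. *)
Inductive npath (T : Type) (E : T -> T -> Type) : nat -> T -> T -> Type :=
| pnil a : npath E 0 a a
| pcons n a b c : E a b -> npath E n b c -> npath E n.+1 a c.
Arguments pnil {T E} a.
Arguments pcons {T E n a b c} x w.

Section NPath.
Variables (T : Type) (E : T -> T -> Type).
Implicit Types (a b c : T) (m n : nat).

Definition ncast n n' (e : n = n') a c (w : npath E n a c) : npath E n' a c :=
  eq_rect n (fun k => npath E k a c) w n' e.

Definition ncast_src n a a' (e : a = a') c (w : npath E n a c) : npath E n a' c :=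
  eq_rect a (fun x => npath E n x c) w a' e.

Definition ncast_tgt n a c c' (e : c = c') (w : npath E n a c) : npath E n a c' :=
  eq_rect c (fun x => npath E n a x) w c' e.

Definition npath0_eq a c (w : npath E 0 a c) : a = c :=
  match w in npath _ n x y
    return match n with 0 => x = y | _.+1 => True end with
  | pnil x => erefl x
  | pcons _ _ _ _ _ _ => I
  end.

Definition uncons n a c (w : npath E n.+1 a c) :
    {b : T & (E a b * npath E n b c)%type} :=
  match w in npath _ k x y
    return match k with
           | 0 => unit
           | k'.+1 => {b : T & (E x b * npath E k' b y)%type}
           end with
  | pnil _ => tt
  | pcons _ _ b _ x w' => existT _ b (x, w')
  end.

(** A path of length m + n cut after its first m steps. *)
Record nsplit m n a c := NSplit {
  nmid : T;
  npre : npath E m a nmid;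
  npost : npath E n nmid c }.

Fixpoint split m n : forall a c, npath E (m + n) a c -> nsplit m n a c :=
  match m with
  | 0 => fun a c w => NSplit (pnil a) w
  | m'.+1 => fun a c w =>
      let: existT b (x, w') := uncons w in
      let s := split w' in NSplit (pcons x (npre s)) (npost s)
  end.

Fixpoint ncat m n a b c (v : npath E m a b) : npath E n b c -> npath E (m + n) a c :=
  match v in npath _ k x y return npath E n y c -> npath E (k + n) x c with
  | pnil _ => fun w => w
  | pcons _ _ _ _ x v' => fun w => pcons x (ncat v' w)
  end.

Lemma uncons_eta n a c (w : npath E n.+1 a c) :
  w = pcons (projT2 (uncons w)).1 (projT2 (uncons w)).2.
Proof.
exact: (match w as w0 in npath _ k x y return
    match k return npath E k x y -> Prop with
    | 0 => fun _ => True
    | k'.+1 => fun w0 => w0 = pcons (projT2 (uncons w0)).1 (projT2 (uncons w0)).2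
    end w0 with pnil _ => I | pcons _ _ _ _ _ _ => erefl end).
Qed.

Lemma split_ncat m n a c (w : npath E (m + n) a c) :
  ncat (npre (split w)) (npost (split w)) = w.
Proof.
elim: m a c w => [|m IH] a c //= w.
have := @uncons_eta (m + n) a c w.
by case: (uncons w) => b [x v] /= ->; rewrite IH.
Qed.

Lemma ncat_split m n a b c (v : npath E m a b) (w : npath E n b c) :
  split (ncat v w) = NSplit v w.
Proof. by elim: v c w => [x|k x y z e v IH] c w //=; rewrite IH. Qed.

(** Paths with their length packed, to reason up to equality of lengths. *)
Definition pk n a c (w : npath E n a c) : {k & npath E k a c} :=
  existT (fun k => npath E k a c) n w.

Lemma pk_ncast n n' (e : n = n') a c (w : npath E n a c) : pk (ncast e w) = pk w.
Proof. by case: n' / e. Qed.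

Lemma pk_inj n a c (v w : npath E n a c) : pk v = pk w -> v = w.
Proof. exact: (Eqdep_dec.inj_pair2_eq_dec _ PeanoNat.Nat.eq_dec). Qed.

End NPath.

Record smallCat := SmallCat {
  obj :> Type;
  hom : obj -> obj -> Type;
  idm : forall X, hom X X;
  cmp : forall X Y Z, hom Y Z -> hom X Y -> hom X Z;
  cmp1m : forall X Y (u : hom X Y), cmp (idm Y) u = u;
  cmpm1 : forall X Y (u : hom X Y), cmp u (idm X) = u;
  cmpA : forall W X Y Z (w : hom Y Z) (v : hom X Y) (u : hom W X),
    cmp w (cmp v u) = cmp (cmp w v) u }.
Arguments hom {s} _ _ : rename.
Arguments idm {s} X : rename.
Arguments cmp {s X Y Z} _ _ : rename.

(** [simplex U p X Y]: the p-simplices X = U_0 -> U_1 -> ... -> U_p = Y. *)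
Notation simplex U := (npath (@hom U)).

Fixpoint ncmp (U : smallCat) p (X Y : U) (s : simplex U p X Y) : hom X Y :=
  match s with
  | pnil X => idm X
  | pcons _ _ _ _ u s' => cmp (ncmp s') u
  end.

Definition is_dinj r p (f : {ffun 'I_r.+1 -> 'I_p.+1}) : bool :=
  [&& [forall i : 'I_r.+1, forall j : 'I_r.+1, (i < j)%N ==> (f i < f j)%N],
      f ord0 == ord0 & f ord_max == ord_max].

Definition Dinj r p : finType := {f : {ffun 'I_r.+1 -> 'I_p.+1} | is_dinj f}.

(** [f # i] is the natural number f(i), for i <= r. *)
Definition dval r p (f : Dinj r p) (i : nat) : nat := val f (inord i).
Notation "f # i" := (dval f i) (at level 25).

(** [is_dcomp f1 f2 f] states f = f1 o f2. *)
Definition is_dcomp t r p (f1 : Dinj r p) (f2 : Dinj t r) (f : Dinj t p) : bool :=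
  [forall i, val f i == val f1 (val f2 i)].

Definition dfact t r p (f : Dinj t p) : finType :=
  {g : Dinj r p * Dinj t r | is_dcomp g.1 g.2 f}.

Section DinjTheory.
Local Open Scope nat_scope.

Lemma dval0 r p (f : Dinj r p) : f # 0 = 0.
Proof.
have /and3P[_ /eqP f0 _] := valP f; rewrite /dval.
by have -> : inord 0 = ord0 :> 'I_r.+1; [exact/val_inj/inordK|rewrite f0].
Qed.

Lemma dval_max r p (f : Dinj r p) : f # r = p.
Proof.
have /and3P[_ _ /eqP fr] := valP f; rewrite /dval.
by have -> : inord r = ord_max :> 'I_r.+1; [exact/val_inj/inordK|rewrite fr].
Qed.

Lemma dval_lt r p (f : Dinj r p) i j : i < j -> j <= r -> f # i < f # j.
Proof.
have /and3P[/forallP fm _ _] := valP f => ij jr.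
have /implyP := forallP (fm (inord i)) (inord j).
by rewrite !inordK ?ltnS ?(leq_trans (ltnW ij)) //; apply.
Qed.

Lemma dval_le r p (f : Dinj r p) i j : i <= j -> j <= r -> f # i <= f # j.
Proof. by rewrite leq_eqVlt => /predU1P[->//|ij jr]; exact/ltnW/dval_lt. Qed.

Lemma dval_bound r p (f : Dinj r p) i : f # i <= p.
Proof. by rewrite -ltnS ltn_ord. Qed.

Lemma is_dcompE t r p (f1 : Dinj r p) (f2 : Dinj t r) f i :
  is_dcomp f1 f2 f -> f # i = f1 # (f2 # i).
Proof. by move=> /forallP/(_ (inord i))/eqP fi; rewrite /dval fi inord_val. Qed.

Definition is_dnat r p (h : nat -> nat) : Prop :=
  [/\ forall i j, i < j -> j <= r -> h i < h j, h 0 = 0 & h r = p].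

Lemma dnat_bound r p h i : is_dnat r p h -> i <= r -> h i <= p.
Proof.
case=> hm _ <-; rewrite leq_eqVlt => /predU1P[->//|ir].
exact/ltnW/hm.
Qed.

Lemma mkDinj_subproof r p h (hP : is_dnat r p h) :
  is_dinj [ffun i : 'I_r.+1 => inord (h i) : 'I_p.+1].
Proof.
have [hm h0 hr] := hP; apply/and3P; split.
- apply/forallP => i; apply/forallP => j; apply/implyP => ij.
  have hb (k : 'I_r.+1) : h k < p.+1 by rewrite ltnS (dnat_bound hP) // -ltnS.
  by rewrite !ffunE !inordK ?hb // hm // -ltnS.
- by rewrite ffunE -val_eqE /= h0 inordK.
- by rewrite ffunE -val_eqE /= hr inordK.
Qed.

Definition mkDinj r p h (hP : is_dnat r p h) : Dinj r p :=
  exist _ [ffun i : 'I_r.+1 => inord (h i) : 'I_p.+1] (mkDinj_subproof hP).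

Lemma mkDinjE r p h (hP : is_dnat r p h) i : i <= r -> mkDinj hP # i = h i.
Proof.
by move=> ir; rewrite /dval /= ffunE !inordK // ltnS (dnat_bound hP).
Qed.

Section Truncation.
Variables (r pn p p0 : nat) (f : Dinj (r + pn) (p + p0)) (e : f # r = p).

Lemma dle_subproof : is_dnat r p (dval f).
Proof.
split=> [i j ij jr||//]; last exact: dval0.
by rewrite dval_lt // (leq_trans jr) ?leq_addr.
Qed.

Lemma dgt_subproof : is_dnat pn p0 (fun j => f # (r + j) - p).
Proof.
split=> [i j ij jr||].
- rewrite ltn_sub2rE; first by rewrite dval_lt ?ltn_add2l ?leq_add2l.
  by rewrite -[X in X <= _]e dval_le ?leq_addr ?leq_add2l ?(leq_trans (ltnW ij)).
- by rewrite addn0 e subnn.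
- by rewrite dval_max addKn.
Qed.

(** The truncations f_{<= r} and f_{> r}, when f(r) = p. *)
Definition dle : Dinj r p := mkDinj dle_subproof.
Definition dgt : Dinj pn p0 := mkDinj dgt_subproof.

End Truncation.

(** The numbers f(1) - f(0), ..., f(r) - f(r-1). *)
Definition gaps r p (f : Dinj r p) : seq nat :=
  [seq f # i.+1 - f # i | i <- iota 0 r].

Lemma size_gaps r p (f : Dinj r p) : size (gaps f) = r.
Proof. by rewrite size_map size_iota. Qed.

Lemma sumn_diff (h : nat -> nat) k n :
  (forall i, k <= i < k + n -> h i <= h i.+1) ->
  sumn [seq h i.+1 - h i | i <- iota k n] = h (k + n) - h k.
Proof.
elim: n k => [|n IH] k hm /=; first by rewrite addn0 subnn.
rewrite IH => [|i ?]; last by rewrite hm //; lia.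
have hk : h k <= h k.+1 by rewrite hm //; lia.
suff : h k.+1 <= h (k.+1 + n) by rewrite addnS addSn; lia.
elim: n {IH} hm => [|n IH] hm; first by rewrite addn0.
rewrite addnS (leq_trans (IH _)) ?hm //; last by lia.
by move=> i ?; rewrite hm //; lia.
Qed.

Lemma sumn_gaps r p (f : Dinj r p) : sumn (gaps f) = p.
Proof.
rewrite sumn_diff ?add0n ?dval0 ?dval_max ?subn0 // => i /andP[_ ir].
exact/ltnW/dval_lt.
Qed.

End DinjTheory.

(** Composing consecutive arrows of a simplex in blocks of sizes [ds]. *)
Fixpoint blocks (U : smallCat) (ds : seq nat) :
    forall X Y : U, simplex U (sumn ds) X Y -> simplex U (size ds) X Y :=
  match ds with
  | [::] => fun X Y s => s
  | d :: ds' => fun X Y s =>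
      let t := @split _ _ d (sumn ds') X Y s in
      pcons (ncmp (npre t)) (blocks (npost t))
  end.

(** The r-simplex f(s): its i-th arrow is the composition of the arrows of s
    from the vertex f(i-1) to the vertex f(i). *)
Definition face (U : smallCat) r p (f : Dinj r p) (X Y : U) (s : simplex U p X Y) :
    simplex U r X Y :=
  ncast (size_gaps f) (blocks (ncast (esym (sumn_gaps f)) s)).

Section FaceTheory.
Variable U : smallCat.
Implicit Types X Y Z : U.

Lemma ncmp_ncat m n X Y Z (s : simplex U m X Y) (t : simplex U n Y Z) :
  ncmp (ncat s t) = cmp (ncmp t) (ncmp s).
Proof.
elim: s Z t => [A|k A B C u s IH] Z t /=; first by rewrite cmpm1.
by rewrite IH cmpA.
Qed.

Lemma npath0 X Y (s : simplex U 0 X Y) (e : X = Y) : s = ncast_tgt e (pnil X).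
Proof.
move: (e); refine (match s as w in npath _ n x y return
  match n return npath _ n x y -> Prop with
  | 0 => fun s0 => forall e0 : x = y, s0 = ncast_tgt e0 (pnil x)
  | _ => fun _ => True end w with pnil x => _ | pcons _ _ _ _ _ _ => I end).
by move=> e0; rewrite (Prop_irrelevance e0 erefl).
Qed.

Lemma pk_blocks ds ds' X Y (s : simplex U (sumn ds) X Y)
    (s' : simplex U (sumn ds') X Y) :
  ds = ds' -> pk s = pk s' -> pk (blocks s) = pk (blocks s').
Proof. by move=> e; subst ds' => es; rewrite (pk_inj es). Qed.

Lemma pk_ncat m n n' X Y Z (s : simplex U m X Y) (t : simplex U n Y Z)
    (t' : simplex U n' Y Z) :
  pk t = pk t' -> pk (ncat s t) = pk (ncat s t').
Proof.
move=> e; have en : n = n' := f_equal (fun z => projT1 z) e.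
by subst n'; rewrite (pk_inj e).
Qed.

Lemma pk_ncat2 m m' n n' X Y Z (s : simplex U m X Y) (s' : simplex U m' X Y)
    (t : simplex U n Y Z) (t' : simplex U n' Y Z) :
  pk s = pk s' -> pk t = pk t' -> pk (ncat s t) = pk (ncat s' t').
Proof.
move=> e e'; have em : m = m' := f_equal (fun z => projT1 z) e.
by subst m'; rewrite (pk_inj e); exact: pk_ncat.
Qed.

Lemma pk_ncons n n' X Y Z (u : hom X Y) (t : simplex U n Y Z)
    (t' : simplex U n' Y Z) :
  pk t = pk t' -> pk (pcons u t) = pk (pcons u t').
Proof.
move=> e; have en : n = n' := f_equal (fun z => projT1 z) e.
by subst n'; rewrite (pk_inj e).
Qed.

Lemma pk_ncatA m n k A B C D (s : simplex U m A B) (t : simplex U n B C)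
    (v : simplex U k C D) :
  pk (ncat (ncat s t) v) = pk (ncat s (ncat t v)).
Proof. by elim: s t => [X|i X Y Z u s IH] t //=; apply/pk_ncons/IH. Qed.

Lemma blocks_cat ds1 ds2 X Y Z (s1 : simplex U (sumn ds1) X Y)
    (s2 : simplex U (sumn ds2) Y Z) (s : simplex U (sumn (ds1 ++ ds2)) X Z) :
  pk s = pk (ncat s1 s2) ->
  pk (blocks s) = pk (ncat (blocks s1) (blocks s2)).
Proof.
elim: ds1 X s1 s => [|d ds1 IH] X s1 s.
  have e := npath0_eq s1; case: Y / e s1 s2 => s1 s2.
  by rewrite (npath0 s1 erefl) /= => es; rewrite (pk_inj es).
rewrite -(@split_ncat _ _ d (sumn ds1) _ _ s1) /=.
case: (@split _ _ d (sumn ds1) _ _ s1) => W u v /=.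
rewrite (@ncat_split _ _ d (sumn ds1)) /=.
have e : sumn ds1 + sumn ds2 = sumn (ds1 ++ ds2) by rewrite sumn_cat.
rewrite pk_ncatA => Hs.
have {Hs} -> : s = @ncat _ _ d (sumn (ds1 ++ ds2)) _ _ _ u (ncast e (ncat v s2)).
  by apply: pk_inj; rewrite Hs; apply: pk_ncat; rewrite pk_ncast.
rewrite (@ncat_split _ _ d (sumn (ds1 ++ ds2))) /=; apply: pk_ncons.
by apply: IH; rewrite pk_ncast.
Qed.

Lemma ncmp_blocks ds X Y (s : simplex U (sumn ds) X Y) : ncmp (blocks s) = ncmp s.
Proof.
elim: ds X s => [|d ds IH] X s //=.
by rewrite IH -ncmp_ncat (@split_ncat _ _ d (sumn ds)).
Qed.

Lemma ncmp_pk m n X Y (s : simplex U m X Y) (t : simplex U n X Y) :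
  pk s = pk t -> ncmp s = ncmp t.
Proof.
move=> e; have en : m = n := f_equal (fun z => projT1 z) e.
by subst n; rewrite (pk_inj e).
Qed.

Lemma blocks_blocks (dss : seq (seq nat)) X Y
    (s : simplex U (sumn (map sumn dss)) X Y)
    (t : simplex U (sumn (flatten dss)) X Y)
    (u : simplex U (sumn (map size dss)) X Y) :
  pk s = pk t -> pk u = pk (blocks t) -> pk (blocks s) = pk (blocks u).
Proof.
elim: dss X s t u => [|ds dss IH] X s t u; first by move=> -> ->.
rewrite -(@split_ncat _ _ (sumn ds) (sumn (map sumn dss)) _ _ s) /=.
case: (@split _ _ (sumn ds) (sumn (map sumn dss)) _ _ s) => W s1 s2 /= Ht.
rewrite (@ncat_split _ _ (sumn ds) (sumn (map sumn dss))) /=.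
have e : sumn (map sumn dss) = sumn (flatten dss) by rewrite sumn_flatten.
have Hb := @blocks_cat ds (flatten dss) X W Y s1 (ncast e s2) t.
rewrite {}Hb; last by rewrite -Ht; apply: pk_ncat; rewrite pk_ncast.
have e' : size (flatten dss) = sumn (map size dss) by rewrite size_flatten.
move=> Hu; have {Hu} -> : u = @ncat _ _ (size ds) (sumn (map size dss)) _ _ _
    (blocks s1) (ncast e' (blocks (ncast e s2))).
  by apply: pk_inj; rewrite Hu; apply: pk_ncat; rewrite pk_ncast.
rewrite (@ncat_split _ _ (size ds) (sumn (map size dss))) /= ncmp_blocks.
by apply: pk_ncons; apply: (IH _ _ (ncast e s2)); rewrite pk_ncast.
Qed.

Lemma pk_face r p (f : Dinj r p) X Y (s : simplex U p X Y) ds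
    (s' : simplex U (sumn ds) X Y) :
  gaps f = ds -> pk s = pk s' -> pk (face f s) = pk (blocks s').
Proof. by move=> e es; rewrite /face pk_ncast; apply: pk_blocks; rewrite ?pk_ncast. Qed.

Lemma blocks1 n X Y (s : simplex U (sumn (nseq n 1%N)) X Y) : pk (blocks s) = pk s.
Proof.
elim: n X s => [|n IH] X s //=.
rewrite -(@split_ncat _ _ 1 (sumn (nseq n 1%N)) _ _ s).
case: (@split _ _ 1 (sumn (nseq n 1%N)) _ _ s) => W a b /=.
have [x ->] : exists x : hom X W, a = pcons x (pnil W).
  rewrite (uncons_eta a); case: (uncons a) => V [x w] /=.
  have e := npath0_eq w; case: W / e {a b} w => w.
  by exists x; rewrite (npath0 w erefl).
by rewrite /= cmp1m; apply: pk_ncons; exact: IH.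
Qed.

Local Open Scope nat_scope.

Lemma gaps_id p (f : Dinj p p) : gaps f = nseq p 1.
Proof.
have fi : forall i, i <= p -> f # i = i.
  have lo i : i <= p -> i <= f # i.
    elim: i => // i IH ip.
    by rewrite (leq_ltn_trans (IH (ltnW ip))) // dval_lt.
  have hi k : k <= p -> f # (p - k) + k <= p.
    elim: k => [|k IH] kp; first by rewrite subn0 addn0 dval_max.
    have := IH (ltnW kp).
    have : f # (p - k.+1) < f # (p - k) by apply: dval_lt; lia.
    by lia.
  move=> i ip; have := lo _ ip; have := hi (p - i); rewrite subKn //.
  by move=> /(_ (leq_subr _ _)); lia.
apply: (@eq_from_nth _ 0); rewrite size_gaps ?size_nseq // => i ip.
rewrite nth_nseq ip (nth_map 0) ?size_iota // nth_iota // add0n.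
by rewrite !fi ?subSnn // ltnW.
Qed.

Lemma gaps_comp_gen (g h : nat -> nat) k n p :
  (forall i, k <= i < k + n -> g i <= g i.+1) -> g (k + n) <= p ->
  (forall i, i < p -> h i <= h i.+1) ->
  [seq h (g i.+1) - h (g i) | i <- iota k n] =
  map sumn (reshape [seq g i.+1 - g i | i <- iota k n]
                    [seq h i.+1 - h i | i <- iota (g k) (g (k + n) - g k)]).
Proof.
elim: n k => [|n IH] k gm gp hm //=.
have gk : g k <= g k.+1 by rewrite gm //; lia.
have gn : g k.+1 <= g (k.+1 + n).
  have : forall i, k.+1 <= i < k.+1 + n -> g i <= g i.+1.
    by move=> i ?; rewrite gm //; lia.
  elim: (n) => [|m IHm] H; first by rewrite addn0.
  rewrite addnS (leq_trans (IHm _)) ?H //; last by lia.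
  by move=> i ?; rewrite H //; lia.
rewrite addnS -addSn in gp *.
rewrite -map_take -map_drop take_iota drop_iota sumn_diff; last first.
  by move=> i ?; rewrite hm //; lia.
have -> : g k + minn (g k.+1 - g k) (g (k.+1 + n) - g k) = g k.+1 by lia.
rewrite IH //; last by move=> i ?; rewrite gm //; lia.
have -> : g k + (g k.+1 - g k) = g k.+1 by lia.
by have -> : g (k.+1 + n) - g k - (g k.+1 - g k) = g (k.+1 + n) - g k.+1 by lia.
Qed.

Lemma gaps_comp t r p (f1 : Dinj r p) (f2 : Dinj t r) (f : Dinj t p) :
  is_dcomp f1 f2 f -> gaps f = map sumn (reshape (gaps f2) (gaps f1)).
Proof.
move=> fE; rewrite /gaps.
have := @gaps_comp_gen (dval f2) (dval f1) 0 t r.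
rewrite add0n dval0 dval_max subn0 => <- //.
- by apply: eq_map => i; rewrite !(is_dcompE _ fE).
- by move=> i /andP[_ it]; exact/ltnW/dval_lt.
- by move=> i ir; exact/ltnW/dval_lt.
Qed.

Lemma gaps_trunc r pn p p0 (f : Dinj (r + pn) (p + p0)) (e : f # r = p) :
  gaps f = gaps (dle e) ++ gaps (dgt e).
Proof.
rewrite /gaps iotaD map_cat; congr (_ ++ _).
  apply/eq_in_map => i; rewrite mem_iota add0n => /andP[_ ir].
  by rewrite !mkDinjE // ltnW.
rewrite add0n -[X in iota X _]addn0 iotaDl -map_comp.
apply/eq_in_map => i; rewrite mem_iota add0n => /andP[_ ip] /=.
rewrite !mkDinjE ?(ltnW ip) // addnS.
have : p <= f # (r + i).
  by rewrite -[X in X <= _]e dval_le ?leq_addr ?leq_add2l ?(ltnW ip).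
have : f # (r + i) < f # (r + i).+1 by rewrite dval_lt // -addnS leq_add2l.
by lia.
Qed.

Local Close Scope nat_scope.

Lemma face_id p (f : Dinj p p) X Y (s : simplex U p X Y) : face f s = s.
Proof.
apply: pk_inj.
have e : p = sumn (nseq p 1%N) by rewrite sumn_nseq mul1n.
rewrite (pk_face (s' := ncast e s) (gaps_id f)) ?pk_ncast //.
by rewrite blocks1 pk_ncast.
Qed.

Lemma face_comp t r p (f1 : Dinj r p) (f2 : Dinj t r) (f : Dinj t p) X Y
    (s : simplex U p X Y) :
  is_dcomp f1 f2 f -> face f2 (face f1 s) = face f s.
Proof.
move=> fE; apply: pk_inj; set dss := reshape (gaps f2) (gaps f1).
have e1 : gaps f1 = flatten dss.
  by rewrite reshapeKr // size_gaps sumn_gaps.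
have e2 : gaps f2 = map size dss.
  by rewrite -/(shape _) reshapeKl // size_gaps sumn_gaps.
have p1 : p = sumn (flatten dss) by rewrite -e1 sumn_gaps.
have p2 : p = sumn (map sumn dss) by rewrite -(gaps_comp fE) sumn_gaps.
have r1 : r = sumn (map size dss) by rewrite -e2 sumn_gaps.
transitivity (pk (blocks (ncast r1 (face f1 s)))).
  by apply: pk_face => //; rewrite pk_ncast.
transitivity (pk (blocks (ncast p2 s))); symmetry; last first.
  by apply: pk_face; [exact: gaps_comp|rewrite pk_ncast].
apply: (@blocks_blocks _ _ _ _ (ncast p1 s)); first by rewrite !pk_ncast.
by rewrite pk_ncast; apply: pk_face; rewrite ?pk_ncast.
Qed.

Lemma face_trunc r pn p p0 (f : Dinj (r + pn) (p + p0)) (e : f # r = p) X Y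
    (s : simplex U (p + p0) X Y) :
  ncat (face (dle e) (npre (split s))) (face (dgt e) (npost (split s))) = face f s.
Proof.
apply: pk_inj; have := split_ncat s.
case: (split s) => W s1 s2 /= <-.
have e1 : p = sumn (gaps (dle e)) by rewrite sumn_gaps.
have e2 : p0 = sumn (gaps (dgt e)) by rewrite sumn_gaps.
have e3 : (p + p0)%N = sumn (gaps (dle e) ++ gaps (dgt e)).
  by rewrite -gaps_trunc sumn_gaps.
transitivity (pk (blocks (ncast e3 (ncat s1 s2)))); last first.
  by symmetry; apply: pk_face; [exact: gaps_trunc|rewrite pk_ncast].
transitivity (pk (ncat (blocks (ncast e1 s1)) (blocks (ncast e2 s2)))).
  by apply: pk_ncat2; apply: pk_face; rewrite ?pk_ncast.
by symmetry; apply: blocks_cat; rewrite pk_ncast; apply: pk_ncat2; rewrite pk_ncast.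
Qed.

End FaceTheory.

Section BoxOperad.
Variables (k : comPzRingType) (B : nat -> nat -> nat -> lmodType k).

(** [chain p0 [:: q_1; ...; q_n] pn]: the tuples (x_1, ..., x_n) with x_i in
    B(p_{i-1}, q_i, p_i), for varying intermediate p_1, ..., p_{n-1}. When n = 0
    the number p_0 is still part of the data. *)
Inductive chain : nat -> seq nat -> nat -> Type :=
| cnil p : chain p [::] p
| ccons p0 q p1 qs pn : B p0 q p1 -> chain p1 qs pn -> chain p0 (q :: qs) pn.

Fixpoint ccat p0 qs p1 (c : chain p0 qs p1) :
    forall qs' p2, chain p1 qs' p2 -> chain p0 (qs ++ qs') p2 :=
  match c in chain a qs b return forall qs' p2, chain b qs' p2 -> chain a (qs ++ qs') p2 with
  | cnil _ => fun _ _ c' => c'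
  | ccons _ _ _ _ _ x c0 => fun _ _ c' => ccons x (ccat c0 c')
  end.

Fixpoint chain_multilinear (M : lmodType k) (qs : seq nat) :
    forall p0 pn, (chain p0 qs pn -> M) -> Prop :=
  match qs with
  | [::] => fun _ _ _ => True
  | q :: qs' => fun p0 pn F => forall p1,
      (forall c : chain p1 qs' pn, linear (fun x : B p0 q p1 => F (ccons x c))) /\
      (forall x : B p0 q p1, chain_multilinear (fun c : chain p1 qs' pn => F (ccons x c)))
  end.

(** The data of an associativity relation: for i = 1, ..., n an element
    x_i of B(p_{i-1}, m_i, p_i) and a chain (x^i_1, ..., x^i_{m_i}) starting at
    p^i_0 and ending at p^i_{m_i} = p^{i+1}_0. *)
Inductive dchain : nat -> nat -> seq (seq nat) -> nat -> nat -> Type :=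
| dnil p p' : dchain p p' [::] p p'
| dcons p0 p0' qs p1 p1' qss pn pn' :
    B p0 (size qs) p1 -> chain p0' qs p1' -> dchain p1 p1' qss pn pn' ->
    dchain p0 p0' (qs :: qss) pn pn'.

(** (x_1, ..., x_n) *)
Fixpoint outer p0 p0' qss pn pn' (d : dchain p0 p0' qss pn pn') :
    chain p0 (map size qss) pn :=
  match d in dchain a _ qss b _ return chain a (map size qss) b with
  | dnil p _ => cnil p
  | dcons _ _ _ _ _ _ _ _ x _ d' => ccons x (outer d')
  end.

(** (x^1_1, ..., x^1_{m_1}, ..., x^n_1, ..., x^n_{m_n}) *)
Fixpoint inner p0 p0' qss pn pn' (d : dchain p0 p0' qss pn pn') :
    chain p0' (flatten qss) pn' :=
  match d in dchain _ a qss _ b return chain a (flatten qss) b with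
  | dnil _ p' => cnil p'
  | dcons _ _ _ _ _ _ _ _ _ c d' => ccat c (inner d')
  end.

Definition comp_type : Type := forall p r p0 qs pn,
  B p (size qs) r -> chain p0 qs pn -> B (p + p0) (sumn qs) (r + pn).

(** (mu(x_1; x^1_1, ..., x^1_{m_1}), ..., mu(x_n; x^n_1, ..., x^n_{m_n})) *)
Fixpoint dmap (mu : comp_type) p0 p0' qss pn pn' (d : dchain p0 p0' qss pn pn') :
    chain (p0 + p0') (map sumn qss) (pn + pn') :=
  match d in dchain a a' qss b b' return chain (a + a') (map sumn qss) (b + b') with
  | dnil p p' => cnil (p + p')
  | dcons _ _ _ _ _ _ _ _ x c d' => ccons (mu _ _ _ _ _ x c) (dmap mu d')
  end.

(** The chain (1, ..., 1) of length n. *)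
Fixpoint units (one : B 0 1 0) (n : nat) : chain 0 (nseq n 1%N) 0 :=
  match n with
  | 0 => cnil 0
  | n'.+1 => ccons one (units one n')
  end.

Definition bcast p p' q q' r r' (ep : p = p') (eq : q = q') (er : r = r')
    (x : B p q r) : B p' q' r' :=
  eq_rect p (fun a => B a q' r')
    (eq_rect q (fun b => B p b r') (eq_rect r (fun c => B p q c) x r' er) q' eq) p' ep.

Lemma size_nseq1 n : n = size (nseq n 1%N).
Proof. by rewrite size_nseq. Qed.

Lemma sumn_nseq1 n : sumn (nseq n 1%N) = n.
Proof. by rewrite sumn_nseq mul1n. Qed.

Record boxOperad := BoxOperad {
  bmu : comp_type;
  bunit : {linear k^o -> B 0 1 0};
  bmu_linear : forall p r p0 qs pn (c : chain p0 qs pn),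
    linear (fun x : B p (size qs) r => bmu x c);
  bmu_multilinear : forall p r p0 qs pn (x : B p (size qs) r),
    chain_multilinear (fun c : chain p0 qs pn => bmu x c);
  bmuA : forall p r p0 p0' qss pn pn'
      (x : B p (size qss) r) (d : dchain p0 p0' qss pn pn'),
    bmu (bcast erefl (esym (size_map sumn qss)) erefl x) (dmap bmu d) =
    bcast (esym (addnA p p0 p0')) (sumn_flatten qss) (esym (addnA r pn pn'))
      (bmu (bcast erefl (esym (size_flatten qss)) erefl
              (bmu (bcast erefl (esym (size_map size qss)) erefl x) (outer d)))
           (inner d));
  bmu_1r : forall p n r (x : B p n r),
    bcast (addn0 p) (sumn_nseq1 n) (addn0 r)
      (bmu (bcast erefl (size_nseq1 n) erefl x) (units (bunit 1) n)) = x;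
  bmu_1l : forall p q r (x : B p q r),
    bcast (add0n p) (addn0 q) (add0n r)
      (@bmu 0 0 p [:: q] r (bunit 1) (ccons x (cnil r))) = x }.

End BoxOperad.

Record quiver (k : comPzRingType) (U : smallCat) := Quiver {
  qob : U -> Type;
  qarr : forall X : U, qob X -> qob X -> lmodType k;
  qstar : forall X Y : U, hom X Y -> qob Y -> qob X }.
Arguments qob {k U} _ _.
Arguments qarr {k U _ X} _ _.
Arguments qstar {k U _ X Y} _ _.

(** [word Q X q A A']: the q-tuples of composable arrows of Q(X) from A to A',
    through arbitrary intermediate objects. *)
Notation word Q X := (npath (fun A A' : qob Q X => GRing.Lmodule.sort (qarr A A'))).

Section Quiver.
Variables (k : comPzRingType) (U : smallCat) (Q : quiver k U).

(** For fixed A_0 = A and A_q = A': k-linearity in each variable, for every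
    choice of A_1, ..., A_{q-1}. *)
Fixpoint word_multilinear (X : U) (M : lmodType k) (q : nat) :
    forall A A' : qob Q X, (word Q X q A A' -> M) -> Prop :=
  match q with
  | 0 => fun _ _ _ => True
  | q'.+1 => fun A A' F => forall A1,
      (forall w : word Q X q' A1 A', linear (fun a : qarr A A1 => F (pcons a w))) /\
      (forall a : qarr A A1, word_multilinear (fun w : word Q X q' A1 A' => F (pcons a w)))
  end.

Fixpoint star p (X Y : U) (s : simplex U p X Y) : qob Q Y -> qob Q X :=
  match s with
  | pnil _ => id
  | pcons _ _ _ _ u s' => fun A => qstar u (star s' A)
  end.

Lemma star_ncat m n X Y Z (s : simplex U m X Y) (t : simplex U n Y Z) A :
  star (ncat s t) A = star s (star t A).
Proof. by elim: s t A => [W|i W W' Y' u s IH] t A //=; rewrite IH. Qed.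

(** An element of C^{p,q,r} is a family of multilinear maps: [th X Y s f A A' w]
    is the value at w = a_1 (x) ... (x) a_q of the component of th at the simplex
    s, the map f and the objects A_0 = A, ..., A_q = A' underlying w. If p < r,
    there is no f and C^{p,q,r} = 0, see [Cbox_eq0]. *)
Record Cbox (p q r : nat) := MkCbox {
  cbox :> forall (X Y : U) (s : simplex U p X Y) (f : Dinj r p) (A A' : qob Q Y),
    word Q Y q A A' -> qarr (star s A) (star (face f s) A');
  cboxP : forall X Y s f A A', word_multilinear (@cbox X Y s f A A') }.

Section CboxModule.
Variables p q r : nat.
Local Notation C := (Cbox p q r).

Lemma cbox_eqP (th th' : C) :
  (forall X Y s f A A' w, th X Y s f A A' w = th' X Y s f A A' w) -> th = th'.
Proof.
case: th th' => [t tP] [t' tP'] /= H.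
have e : t = t' by do 7 (apply: functional_extensionality_dep => ?); exact: H.
by subst t'; rewrite (Prop_irrelevance tP tP').
Qed.

Lemma word_multilinear0 X (M : lmodType k) n (A A' : qob Q X) :
  word_multilinear (fun _ : word Q X n A A' => 0 : M).
Proof.
elim: n A A' => // n IH A A' A1; split=> [w a x y|a]; last exact: IH.
by rewrite scaler0 addr0.
Qed.

Lemma word_multilinearD X (M : lmodType k) n (A A' : qob Q X)
    (F G : word Q X n A A' -> M) :
  word_multilinear F -> word_multilinear G -> word_multilinear (fun w => F w + G w).
Proof.
elim: n A A' F G => // n IH A A' F G FP GP A1.
have [Fl Fm] := FP A1; have [Gl Gm] := GP A1; split=> [w a x y|a]; last first.
  exact: (IH _ _ _ _ (Fm a) (Gm a)).
by rewrite Fl Gl scalerDr addrACA.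
Qed.

Lemma word_multilinearZ X (M : lmodType k) n (A A' : qob Q X) (c : k)
    (F : word Q X n A A' -> M) :
  word_multilinear F -> word_multilinear (fun w => c *: F w).
Proof.
elim: n A A' F => // n IH A A' F FP A1.
have [Fl Fm] := FP A1; split=> [w a x y|a]; last first.
  exact: (IH _ _ _ (Fm a)).
by rewrite Fl scalerDr !scalerA mulrC.
Qed.

Lemma word_multilinearN X (M : lmodType k) n (A A' : qob Q X)
    (F : word Q X n A A' -> M) :
  word_multilinear F -> word_multilinear (fun w => - F w).
Proof.
move=> FP; have -> : (fun w => - F w) = (fun w => -1 *: F w).
  by apply: functional_extensionality_dep => w; rewrite scaleN1r.
exact: word_multilinearZ.
Qed.

Definition cbox0 : C :=
  MkCbox (fun X Y s f A A' => @word_multilinear0 Y (qarr _ _) q A A').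
Definition cboxD (th th' : C) : C :=
  MkCbox (fun X Y s f A A' => word_multilinearD (@cboxP _ _ _ th X Y s f A A')
                                                (@cboxP _ _ _ th' X Y s f A A')).
Definition cboxN (th : C) : C :=
  MkCbox (fun X Y s f A A' => word_multilinearN (@cboxP _ _ _ th X Y s f A A')).
Definition cboxZ (c : k) (th : C) : C :=
  MkCbox (fun X Y s f A A' => word_multilinearZ c (@cboxP _ _ _ th X Y s f A A')).

HB.instance Definition _ := gen_eqMixin C.
HB.instance Definition _ := gen_choiceMixin C.

Fact cboxDA : associative cboxD.
Proof. by move=> ? ? ?; apply: cbox_eqP => *; rewrite /= addrA. Qed.
Fact cboxDC : commutative cboxD.
Proof. by move=> ? ?; apply: cbox_eqP => *; rewrite /= addrC. Qed.
Fact cbox0D : left_id cbox0 cboxD.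
Proof. by move=> ?; apply: cbox_eqP => *; rewrite /= add0r. Qed.
Fact cboxND : left_inverse cbox0 cboxN cboxD.
Proof. by move=> ?; apply: cbox_eqP => *; rewrite /= addNr. Qed.

HB.instance Definition _ := GRing.isZmodule.Build C cboxDA cboxDC cbox0D cboxND.

Fact cboxZA (a b : k) (th : C) : cboxZ a (cboxZ b th) = cboxZ (a * b) th.
Proof. by apply: cbox_eqP => *; rewrite /= scalerA. Qed.
Fact cboxZ1 : left_id 1 cboxZ.
Proof. by move=> ?; apply: cbox_eqP => *; rewrite /= scale1r. Qed.
Fact cboxZDr : right_distributive cboxZ +%R.
Proof. by move=> ? ? ?; apply: cbox_eqP => *; rewrite /= scalerDr. Qed.
Fact cboxZDl (th : C) : {morph cboxZ^~ th : a b / a + b}.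
Proof. by move=> ? ?; apply: cbox_eqP => *; rewrite /= scalerDl. Qed.

HB.instance Definition _ :=
  GRing.Zmodule_isLmodule.Build k C cboxZA cboxZ1 cboxZDr cboxZDl.

Lemma Cbox_eq0 (th : C) : (p < r)%N -> th = 0.
Proof.
move=> pr; apply: cbox_eqP => X Y s f; suff : (r <= p)%N by rewrite leqNgt pr.
suff H i : (i <= r)%N -> (i <= f # i)%N by rewrite (leq_trans (H r _)) ?dval_bound.
by elim: i => // i IH ir; rewrite (leq_ltn_trans (IH (ltnW ir))) // dval_lt.
Qed.

End CboxModule.

Definition Cmod (p q r : nat) : lmodType k := Cbox p q r.

Definition acast (X : U) (A A' B B' : qob Q X) (eA : A = A') (eB : B = B')
    (a : qarr A B) : qarr A' B' :=
  eq_rect A (fun Z => qarr Z B') (eq_rect B (fun Z => qarr A Z) a B' eB) A' eA.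

Lemma tens_nil_subproof p X Y (s : simplex U p X Y) (f : Dinj p p) (A A' : qob Q Y)
    (w : word Q Y 0 A A') : star s A = star (face f s) A'.
Proof. by rewrite face_id (npath0_eq w). Qed.

Lemma tens_cons_subproof t r p X Y (s : simplex U p X Y) (f : Dinj t p)
    (g : dfact r f) (A : qob Q Y) :
  star (face (val g).2 (face (val g).1 s)) A = star (face f s) A.
Proof. by rewrite (face_comp s (valP g)). Qed.

(** The value at w of the (s, f)-component of th_1 (x) ... (x) th_n, as a formal
    sum (a sequence) of elementary tensors b_1 (x) ... (x) b_n of composable
    arrows; the tensor product is bracketed to the right. *)
Fixpoint tens p0 qs pn (c : chain Cmod p0 qs pn) :
    forall (X Y : U) (s : simplex U p0 X Y) (f : Dinj pn p0) (A A' : qob Q Y),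
      word Q Y (sumn qs) A A' ->
      seq (word Q X (size qs) (star s A) (star (face f s) A')) :=
  match c in chain _ a qs b return
    forall (X Y : U) (s : simplex U a X Y) (f : Dinj b a) (A A' : qob Q Y),
      word Q Y (sumn qs) A A' ->
      seq (word Q X (size qs) (star s A) (star (face f s) A')) with
  | cnil p => fun X Y s f A A' w =>
      [:: ncast_tgt (tens_nil_subproof s f w) (pnil (star s A))]
  | ccons _ q p1 qs' _ th c' => fun X Y s f A A' w =>
      let w12 := @split _ _ q (sumn qs') A A' w in
      [seq pcons ((th : Cbox _ _ _) X Y s (val g).1 A (nmid w12) (npre w12))
                 (ncast_tgt (tens_cons_subproof s g A') v)
        | g <- enum (dfact p1 f),
          v <- tens c' (face (val g).1 s) (val g).2 (npost w12)]
  end.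

Section Trunc.
Variables (r pn p p0 : nat) (X Y : U) (s : simplex U (p + p0) X Y).

Definition sle : simplex U p X (nmid (split s)) := npre (split s).
Definition sgt : simplex U p0 (nmid (split s)) Y := npost (split s).

Lemma star_trunc (A : qob Q Y) : star sle (star sgt A) = star s A.
Proof. by rewrite -star_ncat split_ncat. Qed.

Lemma star_face_trunc (f : Dinj (r + pn) (p + p0)) (e : f # r = p) (A : qob Q Y) :
  star (face (dle e) sle) (star (face (dgt e) sgt) A) = star (face f s) A.
Proof. by rewrite -star_ncat face_trunc. Qed.

End Trunc.

Lemma star_face_id p (f : Dinj p p) X Y (s : simplex U p X Y) (A : qob Q Y) :
  star s A = star (face f s) A.
Proof. by rewrite face_id. Qed.

End Quiver.

(* Main.v *)
Require Import Defs.
From mathcomp Require Import all_boot all_algebra.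
From HB Require Import structures.
From mathcomp Require Import boolp zify.

Set Implicit Arguments.
Unset Strict Implicit.
Unset Printing Implicit Defensive.

Import GRing.Theory.
Local Open Scope ring_scope.

(** Why the axioms hold. Everything rests on one bijection: an injection
    f : [r + pn] -> [p + p0] in Delta_f^inj with f(r) = p is the concatenation
    [dcat a b] of a unique pair of injections a : [r] -> [p], b : [pn] -> [p0],
    and this concatenation commutes with composition ([dcat_comp]), is
    associative ([dcatA]), and gives the faces of a concatenated simplex
    factor by factor ([face_dcat]). The composition of the box operad can
    therefore be written as a sum over all pairs (a, b) with [dcat a b] = f,
    which is empty when f(r) <> p ([mu_val]).

    With this formula, the (sigma, f)-component of either side of the
    associativity relation becomes a sum over all ways of cutting f and
    factoring its pieces. On the side mu(x; mu(x_1; ...), ...), the tensor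
    product of the mu(x_i; ...) sums over factorizations of the second piece of
    f, and each factor g_i contributes only when it is itself a concatenation.
    On the other side, f is first cut in three pieces, and the last two are
    factored separately. The two index sets correspond because concatenation
    commutes with composition. This is [tens_sum_dmap], proved by induction on
    the number of x_i from the description of a tensor product of a concatenated
    family ([tens_sum_ccat]) and the reindexing [sum_dcat_comp]; it reduces
    associativity to cutting f in three ([sum_dcatA]). The unit laws hold because
    the only injection [p] -> [p] is the identity.

    The objects at the ends of an arrow are indices of its type, and in all
    these identities they agree only up to a proof. So sums of values are
    computed on plain lists of arrows that carry their ends ([arrow], [raw]):
    a multilinear map on composable words is extended by zero to all lists
    ([word_ext]), and the component of x_1 (x) ... (x) x_n is seen through what
    it does to an arbitrary function on lists ([tens_sum]). A value is brought
    back into a prescribed module of arrows by [fit]. *)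

(** * Injections preserving the end points *)

Section DinjAlgebra.
Local Open Scope nat_scope.

Lemma dinj_ext r p (f g : Dinj r p) : (forall i, i <= r -> f # i = g # i) -> f = g.
Proof.
move=> fg; apply/val_inj/ffunP => i; apply/val_inj.
by have := fg i; rewrite /dval inord_val -ltnS ltn_ord => /(_ isT).
Qed.

Lemma dinj_id p (f : Dinj p p) i : i <= p -> f # i = i.
Proof.
have step j : j < p -> f # j.+1 - f # j = 1.
  move=> jp; have := congr1 (fun l => nth 0 l j) (gaps_id f).
  by rewrite nth_nseq jp (nth_map 0) ?size_iota // nth_iota.
elim: i => [|i IH] ip; first exact: dval0.
by have := step i ip; rewrite IH ?(ltnW ip) //; lia.
Qed.

(** This is what makes the unit laws hold, and the tensor product of no factors
    trivial: only the identity occurs. *)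
Lemma dinj_uniq p (f g : Dinj p p) : f = g.
Proof. by apply: dinj_ext => i ip; rewrite !dinj_id. Qed.

Lemma did_subproof p : is_dnat p p id.
Proof. by []. Qed.

Definition did p : Dinj p p := mkDinj (did_subproof p).

Lemma dcomp_subproof t r p (g : Dinj r p) (h : Dinj t r) :
  is_dnat t p (fun i => g # (h # i)).
Proof.
split=> [i j ij jt||]; rewrite ?dval0 ?dval_max //.
by rewrite dval_lt ?dval_bound ?dval_lt.
Qed.

Definition dcomp t r p (g : Dinj r p) (h : Dinj t r) : Dinj t p :=
  mkDinj (dcomp_subproof g h).

Lemma dcompE t r p (g : Dinj r p) (h : Dinj t r) i :
  i <= t -> dcomp g h # i = g # (h # i).
Proof. exact: mkDinjE. Qed.

Lemma is_dcomp_eq t r p (g : Dinj r p) (h : Dinj t r) (f : Dinj t p) :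
  is_dcomp g h f = (dcomp g h == f).
Proof.
apply/idP/eqP => [gh|<-].
  by apply: dinj_ext => i it; rewrite dcompE // (is_dcompE _ gh).
apply/forallP => i; have it : i <= t by rewrite -ltnS.
have := dcompE g h it; rewrite /dval !inord_val => e.
by rewrite -val_eqE /= e.
Qed.

Lemma dcompA s t r p (g : Dinj r p) (h : Dinj t r) (l : Dinj s t) :
  dcomp g (dcomp h l) = dcomp (dcomp g h) l.
Proof. by apply: dinj_ext => i it; rewrite !dcompE ?dval_bound. Qed.

Lemma dcomp_idl r p (g : Dinj p p) (f : Dinj r p) : dcomp g f = f.
Proof. by apply: dinj_ext => i ir; rewrite dcompE // dinj_id ?dval_bound. Qed.

Lemma dcomp_idr r p (f : Dinj r p) (g : Dinj r r) : dcomp f g = f.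
Proof. by apply: dinj_ext => i ir; rewrite dcompE // dinj_id. Qed.

Lemma dcat_subproof r pn p p0 (a : Dinj r p) (b : Dinj pn p0) :
  is_dnat (r + pn) (p + p0) (fun i => if i <= r then a # i else p + b # (i - r)).
Proof.
split=> [i j ij jr||]; rewrite ?leq0n ?dval0 //; last first.
  case: leqP => [rp|_]; last by rewrite addKn dval_max.
  have pn0 : pn = 0 by lia.
  have p00 : p0 = 0 by rewrite -[LHS](dval_max b) [X in b # X]pn0 dval0.
  by rewrite [X in a # X](_ : _ = r) ?dval_max ?p00 ?addn0 // pn0 addn0.
case: (leqP j r) => jr'; first by rewrite ifT ?dval_lt //; lia.
have jb : b # 0 < b # (j - r) by rewrite dval_lt; lia.
case: (leqP i r) => ir; last by rewrite ltn_add2l dval_lt //; lia.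
by rewrite (leq_ltn_trans (dval_bound a i)) // -[X in X < _]addn0 ltn_add2l -(dval0 b).
Qed.

Definition dcat r pn p p0 (a : Dinj r p) (b : Dinj pn p0) : Dinj (r + pn) (p + p0) :=
  mkDinj (dcat_subproof a b).

Section Dcat.
Variables (r pn p p0 : nat) (a : Dinj r p) (b : Dinj pn p0).

Lemma dcatl i : i <= r -> dcat a b # i = a # i.
Proof. by move=> ir; rewrite mkDinjE ?ir // (leq_trans ir) ?leq_addr. Qed.

Lemma dcatr i : i <= pn -> dcat a b # (r + i) = p + b # i.
Proof.
move=> ip; rewrite mkDinjE ?leq_add2l // addKn; case: leqP => // ri.
by have -> : i = 0; rewrite ?addn0 ?dval0 ?dval_max ?addn0 //; lia.
Qed.

Lemma dcat_mid : dcat a b # r = p.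
Proof. by rewrite dcatl ?dval_max. Qed.

End Dcat.

Lemma dcat_trunc r pn p p0 (f : Dinj (r + pn) (p + p0)) (e : f # r = p) :
  dcat (dle e) (dgt e) = f.
Proof.
apply: dinj_ext => i irp; case: (leqP i r) => ir.
  by rewrite dcatl // mkDinjE.
have -> : i = r + (i - r) by lia.
rewrite dcatr ?mkDinjE; [|lia..].
have : p <= f # (r + (i - r)) by rewrite -[X in X <= _]e dval_le; lia.
by lia.
Qed.

Lemma dcat_inj r pn p p0 (a a' : Dinj r p) (b b' : Dinj pn p0) :
  dcat a b = dcat a' b' -> a = a' /\ b = b'.
Proof.
move=> e; split; apply: dinj_ext => i ir.
  by rewrite -(dcatl a b) // e dcatl.
by apply: (@addnI p); rewrite -(dcatr a b) // e dcatr.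
Qed.

Lemma dcatA r pn rn p p0 p' (a : Dinj r p) (b : Dinj pn p0) (c : Dinj rn p') i :
  i <= r + (pn + rn) -> dcat (dcat a b) c # i = dcat a (dcat b c) # i.
Proof.
move=> ib; case: (leqP i r) => ir.
  by rewrite !dcatl // (leq_trans ir) ?leq_addr.
case: (leqP i (r + pn)) => irp.
  rewrite dcatl //; have -> : i = r + (i - r) by lia.
  by rewrite !dcatr ?dcatl //; lia.
have -> : i = r + (pn + (i - r - pn)) by lia.
by rewrite !dcatr 1?addnA ?dcatr ?addnA //; lia.
Qed.

(** The combinatorial heart of associativity. *)
Lemma dcat_comp r rn t tn p p0 (a : Dinj r p) (a' : Dinj t r)
    (b : Dinj rn p0) (b' : Dinj tn rn) :
  dcomp (dcat a b) (dcat a' b') = dcat (dcomp a a') (dcomp b b').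
Proof.
apply: dinj_ext => i irp; rewrite dcompE //; case: (leqP i t) => it.
  by rewrite !dcatl ?dcompE ?dval_bound.
have -> : i = t + (i - t) by lia.
by rewrite !dcatr ?dcompE ?dval_bound //; lia.
Qed.

End DinjAlgebra.

(** * Sums over factorizations *)

Section FactorizationSums.
Variable M : nmodType.

(** The index set [dfact r f] of a tensor product, unfolded into two independent
    sums, which can be exchanged and reindexed without dependent types. *)
Lemma sum_dfact t r p (f : Dinj t p) (F : Dinj r p -> Dinj t r -> M) :
  \sum_(g <- enum (dfact r f)) F (val g).1 (val g).2 =
  \sum_g \sum_(h | dcomp g h == f) F g h.
Proof.
rewrite big_enum pair_big_dep /=.
under [RHS]eq_bigl do rewrite -is_dcomp_eq.
rewrite (reindex_omap (val : dfact r f -> _) insub) => [|x xP]; last by rewrite insubT.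
by apply: eq_bigl => g; rewrite (valP g) valK eqxx.
Qed.

(** Both sides run over the factorizations of f into three injections. *)
Lemma sum_dcompA s t r p (f : Dinj s p) (F : Dinj r p -> Dinj t r -> Dinj s t -> M) :
  \sum_g \sum_(gh | dcomp g gh == f) \sum_h \sum_(l | dcomp h l == gh) F g h l =
  \sum_gh \sum_(l | dcomp gh l == f) \sum_g \sum_(h | dcomp g h == gh) F g h l.
Proof.
transitivity (\sum_g \sum_h \sum_(l | dcomp (dcomp g h) l == f) F g h l).
  apply: eq_bigr => g _; rewrite exchange_big; apply: eq_bigr => h _ /=.
  rewrite (exchange_big_dep predT) //= [RHS]big_mkcond /=; apply: eq_bigr => l _.
  rewrite -dcompA; case: eqVneq => e; last first.
    by apply: big1 => x /andP[/eqP ? /eqP ?]; case/eqP: e; congruence.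
  apply: (big_pred1 (dcomp h l)) => x /=; rewrite andbC [_ == x]eq_sym.
  by case: (eqVneq x (dcomp h l)) => // ->; rewrite e eqxx.
symmetry.
transitivity (\sum_gh \sum_g \sum_(h | dcomp g h == gh) \sum_(l | dcomp gh l == f) F g h l).
  apply: eq_bigr => gh _; rewrite exchange_big; apply: eq_bigr => g _.
  by rewrite exchange_big.
rewrite exchange_big; apply: eq_bigr => g _ /=.
rewrite (exchange_big_dep predT) //=; apply: eq_bigr => h _.
by rewrite (big_pred1 (dcomp g h)) // => x; rewrite eq_sym.
Qed.

Lemma sum_dcomp_idl r p (f : Dinj r p) (F : Dinj p p -> Dinj r p -> M) :
  \sum_g \sum_(h | dcomp g h == f) F g h = F (did p) f.
Proof.
rewrite (big_pred1 (did p)) => [|g]; last exact/esym/eqP/dinj_uniq.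
by apply: big_pred1 => h; rewrite dcomp_idl.
Qed.

Lemma sum_dcomp_idr r p (f : Dinj r p) (F : Dinj r p -> Dinj r r -> M) :
  \sum_g \sum_(h | dcomp g h == f) F g h = F f (did r).
Proof.
rewrite (bigD1 f) //= [X in _ + X]big1 => [|g gf]; last first.
  by apply: big1 => h; rewrite dcomp_idr (negPf gf).
rewrite addr0; apply: big_pred1 => h; rewrite dcomp_idr eqxx.
exact/esym/eqP/dinj_uniq.
Qed.

Lemma sum_dcat r pn p p0 (f : Dinj (r + pn) (p + p0)) (a : Dinj r p) (b : Dinj pn p0)
    (F : Dinj r p -> Dinj pn p0 -> M) :
  dcat a b = f -> \sum_a' \sum_(b' | dcat a' b' == f) F a' b' = F a b.
Proof.
move=> <-; rewrite pair_big_dep (big_pred1 (a, b)) // => -[a' b'] /=.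
by apply/eqP/eqP => [|[-> ->] //]; move=> /dcat_inj[-> ->].
Qed.

Lemma sum_dcat0 r pn p p0 (f : Dinj (r + pn) (p + p0)) (F : Dinj r p -> Dinj pn p0 -> M) :
  f # r <> p -> \sum_a \sum_(b | dcat a b == f) F a b = 0.
Proof.
by move=> fr; apply: big1 => a _; apply: big1 => b /eqP e; case: fr; rewrite -e dcat_mid.
Qed.

(** Terms where g does not map the cut r to the cut p are zero; the others are
    indexed by the two truncations of g. *)
Lemma sum_dcat_all r pn p p0 (F : Dinj (r + pn) (p + p0) -> M) :
  (forall f, f # r <> p -> F f = 0) ->
  \sum_f F f = \sum_a \sum_b F (dcat a b).
Proof.
move=> F0; rewrite pair_big /=.
rewrite (eq_bigr (fun f => \sum_(x : Dinj r p * Dinj pn p0 | dcat x.1 x.2 == f) F f)).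
  rewrite (exchange_big_dep predT) //=; apply: eq_bigr => x _.
  by rewrite (big_pred1 (dcat x.1 x.2)) // => y; rewrite eq_sym.
move=> f _; case: (pselect (f # r = p)) => [e|/F0 ->]; last by rewrite big1.
rewrite (big_pred1 (dle e, dgt e)) // => -[a b].
apply/eqP/eqP => /= [|[-> ->]]; last exact: dcat_trunc.
by rewrite -[X in _ = X](dcat_trunc e) => /dcat_inj[-> ->].
Qed.

Lemma sum_fiber (I J : finType) (P : pred J) (h : I -> J) (F : I -> M) :
  \sum_(j | P j) \sum_(i | h i == j) F i = \sum_(i | P (h i)) F i.
Proof.
rewrite (exchange_big_dep predT) //= [RHS]big_mkcond; apply: eq_bigr => i _ /=.
case: ifP => Pi.
  apply: (big_pred1 (h i)) => j /=; rewrite eq_sym.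
  by case: (eqVneq j (h i)) => [->|]; rewrite ?Pi ?andbF.
by apply: big1 => j /andP[Pj /eqP e]; rewrite -e Pi in Pj.
Qed.

(** By [dcat_comp], both sides run over the quadruples (a, b, a', b') such that
    the concatenation of a o a' and b o b' is f. *)
Lemma sum_dcat_comp r rn t tn p p0 (f : Dinj (t + tn) (p + p0))
    (F : Dinj r p -> Dinj rn p0 -> Dinj t r -> Dinj tn rn -> M) :
  \sum_a \sum_b \sum_(h | dcomp (dcat a b) h == f)
    \sum_a' \sum_(b' | dcat a' b' == h) F a b a' b' =
  \sum_aa \sum_(bb | dcat aa bb == f)
    \sum_b \sum_(b' | dcomp b b' == bb) \sum_a \sum_(a' | dcomp a a' == aa) F a b a' b'.
Proof.
pose C (a : Dinj r p) (b : Dinj rn p0) (a' : Dinj t r) (b' : Dinj tn rn) :=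
  dcat (dcomp a a') (dcomp b b') == f.
transitivity (\sum_a \sum_b \sum_a' \sum_b' if C a b a' b' then F a b a' b' else 0).
  apply: eq_bigr => a _; apply: eq_bigr => b _.
  under eq_bigr do rewrite pair_big_dep /=.
  rewrite (sum_fiber _ (fun x => dcat x.1 x.2)) big_mkcond pair_bigA /=.
  by apply: eq_bigr => x _; rewrite dcat_comp.
symmetry.
transitivity (\sum_b \sum_b' \sum_a \sum_a' if C a b a' b' then F a b a' b' else 0).
  under eq_bigr => aa _ do under eq_bigr => bb _ do rewrite pair_big_dep /=.
  under eq_bigr => aa _ do rewrite (sum_fiber _ (fun x => dcomp x.1 x.2)).
  rewrite (exchange_big_dep predT) //= pair_bigA; apply: eq_bigr => x _ /=.
  under eq_bigr do rewrite pair_big_dep /=.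
  by rewrite (sum_fiber _ (fun x => dcomp x.1 x.2)) big_mkcond pair_bigA.
rewrite [RHS]exchange_big; apply: eq_bigr => b _ /=.
rewrite exchange_big; apply: eq_bigr => a _ /=; exact: exchange_big.
Qed.

(** Two ways of cutting f in three pieces. The types of f and f' differ by the
    associativity of addition, so f = f' is expressed on values. *)
Lemma sum_dcatA r pn rn p p0 p' (f : Dinj (r + (pn + rn)) (p + (p0 + p')))
    (f' : Dinj ((r + pn) + rn) ((p + p0) + p'))
    (F : Dinj r p -> Dinj pn p0 -> Dinj rn p' -> M) :
  (forall i, (i <= r + (pn + rn))%N -> f # i = f' # i) ->
  \sum_a \sum_(bc | dcat a bc == f) \sum_b \sum_(c | dcat b c == bc) F a b c =
  \sum_ab \sum_(c | dcat ab c == f') \sum_a \sum_(b | dcat a b == ab) F a b c.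
Proof.
move=> ff'.
transitivity (\sum_a \sum_b \sum_(c | dcat a (dcat b c) == f) F a b c).
  apply: eq_bigr => a _; under eq_bigr do rewrite pair_big_dep /=.
  by rewrite (sum_fiber _ (fun x => dcat x.1 x.2)) pair_big_dep.
transitivity (\sum_c \sum_a \sum_(b | dcat (dcat a b) c == f') F a b c); last first.
  rewrite [RHS](exchange_big_dep predT) //=; apply: eq_bigr => c _.
  under [RHS]eq_bigr do rewrite pair_big_dep /=.
  by rewrite (sum_fiber _ (fun x => dcat x.1 x.2)) pair_big_dep.
rewrite [RHS]exchange_big; apply: eq_bigr => a _ /=.
rewrite [RHS](exchange_big_dep predT) //=; apply: eq_bigr => b _.
apply: eq_bigl => c; apply/eqP/eqP => e; apply: dinj_ext => i ib.
  have ib' : (i <= r + (pn + rn))%N by rewrite addnA.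
  by rewrite -ff' // -e dcatA.
by rewrite ff' // -e dcatA.
Qed.

End FactorizationSums.

(** * Lists of arrows *)

Lemma cons_eq T (x y : T) s t : x :: s = y :: t -> x = y /\ s = t.
Proof. by case. Qed.

Lemma ncat_pnil_r T (E : T -> T -> Type) n a c (w : npath E n a c) :
  pk (ncat w (pnil c)) = pk w.
Proof.
elim: w => // m x y z e w IH /=.
exact: (congr1 (fun v : {j & npath E j y z} => pk (pcons e (projT2 v))) IH).
Qed.

Section Arrows.
Variables (k : comPzRingType) (U : smallCat) (Q : quiver k U).

Section Words.
Variable X : U.

(** Arrows packed with their ends: transporting an arrow along equalities of
    objects does not change the packed arrow. *)
Record arrow := Arrow { asrc : qob Q X; atgt : qob Q X; aval : qarr asrc atgt }.
Arguments Arrow {asrc atgt} aval.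

(** The value 0 at arrows with the wrong ends keeps [fit] total, and linear in the
    arrow once its ends are fixed. *)
Definition fit (A A' : qob Q X) (z : arrow) : qarr A A' :=
  match pselect (asrc z = A), pselect (atgt z = A') with
  | left e, left e' => acast e e' (aval z)
  | _, _ => 0
  end.

Lemma fitE A A' (a : qarr A A') : fit A A' (Arrow a) = a.
Proof.
rewrite /fit /=; case: pselect => // e; case: pselect => // e'.
by rewrite (Prop_irrelevance e erefl) (Prop_irrelevance e' erefl).
Qed.

Lemma fit_acast A A' B B' (e : A = B) (e' : A' = B') (a : qarr A A') :
  acast e e' a = fit B B' (Arrow a).
Proof. by case: B / e; case: B' / e'; rewrite fitE. Qed.

Lemma fit_id A A' B B' (a : qarr A A') :
  A = B -> A' = B' -> Arrow (fit B B' (Arrow a)) = Arrow a.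
Proof. by move=> <- <-; rewrite fitE. Qed.

Lemma fit_linear A A' B B' : linear (fun a : qarr A A' => fit B B' (Arrow a)).
Proof.
move=> c a b; rewrite /fit /=.
case: pselect => [e|_]; last by rewrite scaler0 addr0.
case: pselect => [e'|_]; last by rewrite scaler0 addr0.
by case: B / e; case: B' / e'.
Qed.

Fixpoint raw q (A A' : qob Q X) (w : word Q X q A A') : seq arrow :=
  match w with
  | pnil _ => [::]
  | pcons _ _ _ _ a w' => Arrow a :: raw w'
  end.

Lemma raw_ncat m n A B C (v : word Q X m A B) (w : word Q X n B C) :
  raw (ncat v w) = raw v ++ raw w.
Proof. by elim: v C w => //= *; congr cons; auto. Qed.

Lemma raw_ncast n n' (e : n = n') A A' (w : word Q X n A A') : raw (ncast e w) = raw w.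
Proof. by case: n' / e. Qed.

Lemma raw_ncast_tgt n A A' B (e : A' = B) (w : word Q X n A A') :
  raw (ncast_tgt e w) = raw w.
Proof. by case: B / e. Qed.

Lemma word0 A A' (w : word Q X 0 A A') (e : A = A') : w = ncast_tgt e (pnil A).
Proof.
move: e; refine (match w as w0 in npath _ n x y return
  match n return npath _ n x y -> Prop with
  | 0 => fun w0 => forall e : x = y, w0 = ncast_tgt e (pnil x)
  | _ => fun _ => True end w0 with pnil x => _ | pcons _ _ _ _ _ _ => I end).
by move=> e; rewrite (Prop_irrelevance e erefl).
Qed.

Lemma raw0 A A' (w : word Q X 0 A A') : raw w = [::].
Proof. by rewrite (word0 w (npath0_eq w)) raw_ncast_tgt. Qed.

Lemma word1 A A' (w : word Q X 1 A A') : exists a : qarr A A', raw w = [:: Arrow a].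
Proof.
rewrite (uncons_eta w); case: (uncons w) => B [a v] /=.
by have e := npath0_eq v; case: A' / e {w} v => v; exists a; rewrite raw0.
Qed.

(** A list determines the intermediate objects of a word, hence the word, once
    its two ends are fixed; for empty words the ends are not seen by the list. *)
Lemma raw_inj q A A' : injective (@raw q A A').
Proof.
elim: q A => [|q IH] A v w.
  by rewrite (word0 v (npath0_eq v)) (word0 w (npath0_eq v)).
rewrite (uncons_eta v) (uncons_eta w) /=.
case: (uncons v) => B [a v'] /=; case: (uncons w) => C [b w'] /= E.
have [e vw] := cons_eq E.
move: (congr1 atgt e) => /= eBC.
case: C / eBC b w' e vw {E} => b w' + /(IH B) ->; move=> /(congr1 (@fit A B)).
by rewrite !fitE => ->.
Qed.

Section Extension.
Variable M : lmodType k.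

(** Extension by zero of a function on composable words. Multilinearity survives,
    because composability depends only on the ends of the arrows. *)
Definition word_ext q A A' (G : word Q X q A A' -> M) (l : seq arrow) : M :=
  if pselect (exists w : word Q X q A A', raw w = l) is left H then G (projT1 (cid H))
  else 0.

Lemma word_ext_raw q A A' (G : word Q X q A A' -> M) w : word_ext G (raw w) = G w.
Proof.
rewrite /word_ext; case: pselect => [H|[]]; last by exists w.
by rewrite (raw_inj (projT2 (cid H))).
Qed.

Lemma word_ext_none q A A' (G : word Q X q A A' -> M) l :
  (forall w : word Q X q A A', raw w <> l) -> word_ext G l = 0.
Proof. by move=> H; rewrite /word_ext; case: pselect => // wl; case: wl (wl) => w /H. Qed.

Lemma word_ext_cons q A B A' (a : qarr A B) (G : word Q X q.+1 A A' -> M) l :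
  word_ext G (Arrow a :: l) = word_ext (fun w : word Q X q B A' => G (pcons a w)) l.
Proof.
case: (pselect (exists w : word Q X q B A', raw w = l)) => [[w <-]|H].
  by rewrite word_ext_raw -[_ :: _]/(raw (pcons a w)) word_ext_raw.
rewrite [RHS]word_ext_none => [|w wl]; last by apply: H; exists w.
rewrite word_ext_none // => w; rewrite (uncons_eta w).
case: (uncons w) => C [b v] /= E; have [E1 vl] := cons_eq E.
have /= e : C = B := congr1 atgt E1.
by case: B / e a G H {E E1} => _ _ [] ; exists v.
Qed.

Lemma word_ext_cons0 q A B C A' (a : qarr C B) (G : word Q X q A A' -> M) l :
  A <> C -> word_ext G (Arrow a :: l) = 0.
Proof.
move=> AC; apply: word_ext_none; case: q {G} => [|q] w; first by rewrite raw0.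
rewrite (uncons_eta w); case: (uncons w) => D [b v] /= E; have [E1 _] := cons_eq E.
by case: AC; exact: (congr1 asrc E1).
Qed.

Lemma word_ext_cat m n A B A' (v : word Q X m A B) (G : word Q X (m + n) A A' -> M) l :
  word_ext G (raw v ++ l) = word_ext (fun w : word Q X n B A' => G (ncat v w)) l.
Proof. by elim: v G => // i x y z a v IH G /=; rewrite word_ext_cons IH. Qed.

Lemma eq_word_ext q A A' (G G' : word Q X q A A' -> M) l :
  (forall w, G w = G' w) -> word_ext G l = word_ext G' l.
Proof. by move=> GG'; rewrite /word_ext; case: pselect. Qed.

Lemma word_ext_sum I (r : seq I) (P : pred I) q A A' (G : I -> word Q X q A A' -> M) l :
  word_ext (fun w => \sum_(i <- r | P i) G i w) l = \sum_(i <- r | P i) word_ext (G i) l.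
Proof. by rewrite /word_ext; case: pselect => // H; rewrite big1. Qed.

(** Linearity in each entry while the ends of that entry are fixed. *)
Definition list_multilinear (F : seq arrow -> M) : Prop :=
  forall l1 l2 (A A' : qob Q X), linear (fun a : qarr A A' => F (l1 ++ Arrow a :: l2)).

Lemma list_multilinear_cons (F : seq arrow -> M) z :
  list_multilinear F -> list_multilinear (fun l => F (z :: l)).
Proof. by move=> FP l1; apply: (FP (z :: l1)). Qed.

Lemma list_multilinear_sum I (r : seq I) (P : pred I) (F : I -> seq arrow -> M) :
  (forall i, list_multilinear (F i)) -> list_multilinear (fun l => \sum_(i <- r | P i) F i l).
Proof.
move=> FP l1 l2 A A' c a b; rewrite scaler_sumr -big_split /=.
by apply: eq_bigr => i _; exact: FP.
Qed.

Lemma list_multilinear_word_ext q A A' (G : word Q X q A A' -> M) :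
  word_multilinear G -> list_multilinear (word_ext G).
Proof.
elim: q A G => [|q IH] A G GP l1 l2 B B' c a b.
  by rewrite !word_ext_none ?scaler0 ?addr0 // => w; rewrite raw0; case: (l1).
case: l1 => [|[C C' d] l1] /=.
  have [e|ne] := pselect (A = B); last by rewrite !word_ext_cons0 // scaler0 addr0.
  case: B / e a b => a b; rewrite !word_ext_cons /word_ext.
  case: pselect => [H|_]; last by rewrite scaler0 addr0.
  by have [Gl _] := GP B'; rewrite (Gl (projT1 (cid H))).
have [e|ne] := pselect (A = C); last by rewrite !word_ext_cons0 // scaler0 addr0.
case: C / e d => d; rewrite !word_ext_cons.
by have [_ /(_ d) Gm] := GP C'; apply: IH.
Qed.

Lemma word_multilinear_raw (F : seq arrow -> M) q A A' :
  list_multilinear F -> word_multilinear (fun w : word Q X q A A' => F (raw w)).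
Proof.
elim: q F A => // q IH F A FP B; split=> [w|a]; first exact: (FP [::]).
exact: IH (list_multilinear_cons (Arrow a) FP).
Qed.

Lemma word_multilinear_sum I (r : seq I) q A A' (G : I -> word Q X q A A' -> M) :
  (forall i, word_multilinear (G i)) -> word_multilinear (fun w => \sum_(i <- r) G i w).
Proof.
elim: q A G => // q IH A G GP B; split=> [w c a b|a]; last first.
  by apply: (IH _ (fun i w => G i (pcons a w))) => i; have [_] := GP i B; apply.
rewrite scaler_sumr -big_split; apply: eq_bigr => i _.
by have [+ _] := GP i B; apply.
Qed.

Lemma word_multilinear_comp (N : lmodType k) (h : N -> M) q A A' (G : word Q X q A A' -> N) :
  linear h -> word_multilinear G -> word_multilinear (fun w => h (G w)).
Proof.
move=> hl; elim: q A G => // q IH A G GP B; have [Gl Gm] := GP B.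
split=> [w c a b|a]; first by rewrite Gl hl.
exact: (IH _ (fun w => G (pcons a w)) (Gm a)).
Qed.

(** A tensor product of maps is evaluated on a word cut into two parts: it
    suffices to control each part separately. *)
Lemma word_multilinear_split m n A A' (G : word Q X (m + n) A A' -> M) :
  (forall B (w : word Q X n B A'),
     word_multilinear (fun v : word Q X m A B => G (ncat v w))) ->
  (forall B (v : word Q X m A B),
     word_multilinear (fun w : word Q X n B A' => G (ncat v w))) ->
  word_multilinear G.
Proof.
elim: m A G => [|m IH] A G Gl Gr; first exact: (Gr A (pnil A)).
move=> B; split=> [w|a].
  rewrite -(split_ncat w); case: (Defs.split w) => C v w2 /=.
  by have [+ _] := Gl C w2 B; apply.
apply: (IH _ (fun w => G (pcons a w))) => [C w|C v].
  by have [_] := Gl C w B; apply.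
exact: (Gr C (pcons a v)).
Qed.

End Extension.
End Words.
Arguments Arrow {X asrc atgt} aval.

End Arrows.
Arguments Arrow {k U Q X asrc atgt} aval.

(** * Tensor products of families *)

Section Tensors.
Variables (k : comPzRingType) (U : smallCat) (Q : quiver k U).

(** The image of the (s, f)-component of x_1 (x) ... (x) x_n under the additive
    extension of F to formal sums of words. Quantifying over F replaces equalities
    of formal sums, which would hold only up to reordering. *)
Definition tens_sum (X Y : U) p0 qs pn (c : chain (Cmod Q) p0 qs pn)
    (s : simplex U p0 X Y) (f : Dinj pn p0) (A A' : qob Q Y) (M : lmodType k)
    (F : seq (arrow Q X) -> M) (l : seq (arrow Q Y)) : M :=
  word_ext (fun w : word Q Y (sumn qs) A A' => \sum_(v <- tens c s f w) F (raw v)) l.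

Section Functional.
Variables (X : U) (M : lmodType k).
Implicit Types (Y : U) (F : seq (arrow Q X) -> M).

Lemma tens_sum_raw Y p0 qs pn (c : chain (Cmod Q) p0 qs pn) (s : simplex U p0 X Y) f
    (A A' : qob Q Y) F (w : word Q Y (sumn qs) A A') :
  tens_sum c s f A A' F (raw w) = \sum_(v <- tens c s f w) F (raw v).
Proof. exact: word_ext_raw. Qed.

Lemma eq_tens_sum Y p0 qs pn (c : chain (Cmod Q) p0 qs pn) (s : simplex U p0 X Y) f
    (A A' : qob Q Y) F F' l :
  (forall l', F l' = F' l') -> tens_sum c s f A A' F l = tens_sum c s f A A' F' l.
Proof. by move=> FF'; apply: eq_word_ext => w; apply: eq_bigr. Qed.

Lemma tens_sum0 Y p0 qs pn (c : chain (Cmod Q) p0 qs pn) (s : simplex U p0 X Y) f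
    (A A' : qob Q Y) F l :
  (forall l', F l' = 0) -> tens_sum c s f A A' F l = 0.
Proof. by move=> F0; rewrite /tens_sum /word_ext; case: pselect => // H; rewrite big1. Qed.

Lemma tens_sum_nil Y p (s : simplex U p X Y) (f : Dinj p p) (A A' : qob Q Y) F :
  A = A' -> tens_sum (cnil _ p) s f A A' F [::] = F [::].
Proof.
move=> <-; rewrite [LHS](@tens_sum_raw _ _ _ _ (cnil _ p) s f _ _ F (pnil A)) /= big_seq1.
by rewrite raw_ncast_tgt.
Qed.

Lemma tens_cons_ncat Y p0 q p1 qs pn (th : Cbox Q p0 q p1) (c : chain (Cmod Q) p1 qs pn)
    (s : simplex U p0 X Y) (f : Dinj pn p0) (A A1 A' : qob Q Y) F
    (v : word Q Y q A A1) (w : word Q Y (sumn qs) A1 A') :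
  \sum_(x <- @tens _ _ _ _ (q :: qs) _ (ccons (th : Cmod Q p0 q p1) c)
               _ _ s f A A' (ncat v w)) F (raw x) =
  \sum_(g <- enum (dfact p1 f))
     \sum_(x <- tens c (face (val g).1 s) (val g).2 w)
        F (Arrow (th X Y s (val g).1 A A1 v) :: raw x).
Proof.
rewrite /= (ncat_split v w) /= big_allpairs_dep.
by apply: eq_bigr => g _; apply: eq_bigr => x _ /=; rewrite raw_ncast_tgt.
Qed.

Lemma tens_sum_cons Y p0 q p1 qs pn (th : Cbox Q p0 q p1) (c : chain (Cmod Q) p1 qs pn)
    (s : simplex U p0 X Y) (f : Dinj pn p0) (A A1 A' : qob Q Y) F
    (v : word Q Y q A A1) l :
  tens_sum (ccons (th : Cmod Q p0 q p1) c) s f A A' F (raw v ++ l) =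
  \sum_g \sum_(h | dcomp g h == f)
     tens_sum c (face g s) h A1 A' (fun l' => F (Arrow (th X Y s g A A1 v) :: l')) l.
Proof.
rewrite /tens_sum (@word_ext_cat _ _ _ _ _ q (sumn qs)).
under eq_word_ext do rewrite tens_cons_ncat.
by rewrite word_ext_sum -sum_dfact.
Qed.

Lemma word_multilinear_tens Y p0 qs pn (c : chain (Cmod Q) p0 qs pn) (s : simplex U p0 X Y)
    (f : Dinj pn p0) (A A' : qob Q Y) F :
  list_multilinear F ->
  word_multilinear (fun w : word Q Y (sumn qs) A A' => \sum_(v <- tens c s f w) F (raw v)).
Proof.
elim: c s f A A' F => // {p0 qs pn} p0 q p1 qs pn th c IH s f A A' F FP.
apply: (@word_multilinear_split _ _ _ _ _ q (sumn qs)) => B w;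
  under eq_fun do rewrite tens_cons_ncat.
  apply: word_multilinear_sum => g; apply: word_multilinear_sum => x.
  apply: (word_multilinear_comp (h := fun a => F (Arrow a :: raw x))); first exact: (FP [::]).
  exact: cboxP.
apply: word_multilinear_sum => g.
by apply: (IH _ _ _ _ (fun l => F (_ :: l))); exact: list_multilinear_cons.
Qed.

Lemma list_multilinear_tens_sum Y p0 qs pn (c : chain (Cmod Q) p0 qs pn) (s : simplex U p0 X Y)
    (f : Dinj pn p0) (A A' : qob Q Y) F :
  list_multilinear F -> list_multilinear (tens_sum c s f A A' F).
Proof. by move=> FP; apply/list_multilinear_word_ext/word_multilinear_tens. Qed.

(** Associativity of the tensor product over the quiver: the component of
    (x_1 (x) ... (x) x_m) (x) (y_1 (x) ... (x) y_n) sums over the factorizations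
    f = g o h. By induction on m, the sums over f = g o (h o l) are regrouped as
    sums over f = (g o h) o l. *)
Lemma tens_sum_ccat Y p0 qs p1 (c : chain (Cmod Q) p0 qs p1) qs' pn
    (c' : chain (Cmod Q) p1 qs' pn)
    (s : simplex U p0 X Y) (f : Dinj pn p0) (A A1 A' : qob Q Y) F
    (v : word Q Y (sumn qs) A A1) l :
  tens_sum (ccat c c') s f A A' F (raw v ++ l) =
  \sum_g \sum_(h | dcomp g h == f)
     tens_sum c s g A A1 (fun y => tens_sum c' (face g s) h A1 A' (fun z => F (y ++ z)) l) (raw v).
Proof.
elim: c pn c' s f A F v => {p0 qs p1} [p|p0 q p2 qs p1 th c IH] pn c' s f A F v.
  rewrite sum_dcomp_idl.
  by rewrite raw0 tens_sum_nil ?(npath0_eq v) //= face_id.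
rewrite -(split_ncat (v : word Q Y (q + sumn qs) A A1)).
case: (Defs.split _) => A2 v1 v2 /=.
rewrite raw_ncat -catA tens_sum_cons.
etransitivity.
  by apply: eq_bigr => g _; apply: eq_bigr => h _; exact: IH.
rewrite (sum_dcompA f (fun g h m => tens_sum c (face g s) h A2 A1 (fun y =>
  tens_sum c' (face h (face g s)) m A1 A' (fun z => F (_ :: y ++ z)) l) (raw v2))).
apply: eq_bigr => gh _; apply: eq_bigr => m _; rewrite tens_sum_cons.
apply: eq_bigr => g _; apply: eq_bigr => h; rewrite -is_dcomp_eq => e.
by rewrite (face_comp s e).
Qed.

Lemma tens_sum_sum Y p0 qs pn (c : chain (Cmod Q) p0 qs pn) (s : simplex U p0 X Y) f
    (A A' : qob Q Y) I (r : seq I) (P : pred I) (F : I -> seq (arrow Q X) -> M) l :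
  tens_sum c s f A A' (fun l' => \sum_(i <- r | P i) F i l') l =
  \sum_(i <- r | P i) tens_sum c s f A A' (F i) l.
Proof. by rewrite -word_ext_sum; apply: eq_word_ext => w; exact: exchange_big. Qed.

End Functional.

Lemma linear_big (M N : lmodType k) (h : M -> N) I (r : seq I) (P : pred I) (F : I -> M) :
  linear h -> h (\sum_(i <- r | P i) F i) = \sum_(i <- r | P i) h (F i).
Proof.
move=> hl; have h0 : h 0 = 0 by have := hl (-1) 0 0; rewrite !scaleN1r !addNr.
by apply: big_morph => // x y; have := hl 1 x y; rewrite !scale1r.
Qed.

End Tensors.

(** * The composition maps *)

Section Composition.
Variables (k : comPzRingType) (U : smallCat) (Q : quiver k U).

(** A component of th, as a function on lists with values in a module of arrows
    whose ends B, B' are prescribed independently of th. *)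
Definition eval p q r (th : Cbox Q p q r) (X Y : U) (s : simplex U p X Y) (f : Dinj r p)
    (A A' : qob Q Y) (B B' : qob Q X) : seq (arrow Q Y) -> qarr B B' :=
  word_ext (fun w : word Q Y q A A' => fit B B' (Arrow (th X Y s f A A' w))).

Lemma list_multilinear_eval p q r (th : Cbox Q p q r) X Y (s : simplex U p X Y) f A A' B B' :
  list_multilinear (eval th s f A A' B B').
Proof.
apply: list_multilinear_word_ext.
apply: (word_multilinear_comp (h := fun a => fit B B' (Arrow a))).
  exact: fit_linear.
exact: cboxP.
Qed.

Lemma eval_raw p q r (th : Cbox Q p q r) X Y (s : simplex U p X Y) f A A' B B'
    (w : word Q Y q A A') :
  eval th s f A A' B B' (raw w) = fit B B' (Arrow (th X Y s f A A' w)).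
Proof. exact: word_ext_raw. Qed.

(** When f(r) = p the sum has one term, at the two truncations of f; otherwise it
    is empty. The sum form avoids proofs of f(r) = p inside the formula. *)
Definition mu_val p r p0 qs pn (th : Cbox Q p (size qs) r)
    (c : chain (Cmod Q) p0 qs pn) X Y (s : simplex U (p + p0) X Y)
    (f : Dinj (r + pn) (p + p0)) (A A' : qob Q Y)
    (w : word Q Y (sumn qs) A A') : qarr (star s A) (star (face f s) A') :=
  \sum_a \sum_(b | dcat a b == f)
    tens_sum c (sgt s) b A A'
      (eval th (sle s) a (star (sgt s) A) (star (face b (sgt s)) A') _ _) (raw w).

Lemma word_multilinear_mu p r p0 qs pn (th : Cbox Q p (size qs) r)
    (c : chain (Cmod Q) p0 qs pn) X Y (s : simplex U (p + p0) X Y)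
    (f : Dinj (r + pn) (p + p0)) (A A' : qob Q Y) :
  word_multilinear (@mu_val _ _ _ _ _ th c X Y s f A A').
Proof.
apply: (word_multilinear_raw (F := fun l => \sum_a \sum_(b | dcat a b == f)
  tens_sum c (sgt s) b A A'
  (eval th (sle s) a (star (sgt s) A) (star (face b (sgt s)) A') _ _) l)).
apply: list_multilinear_sum => a; apply: list_multilinear_sum => b.
exact/list_multilinear_tens_sum/list_multilinear_eval.
Qed.

Definition mu : comp_type (Cmod Q) := fun p r p0 qs pn th c => MkCbox (word_multilinear_mu th c).

Lemma mu_ncat p r p0 qs pn (th : Cbox Q p (size qs) r) (c : chain (Cmod Q) p0 qs pn)
    X W Y (s1 : simplex U p X W) (s2 : simplex U p0 W Y)
    (f : Dinj (r + pn) (p + p0)) (A A' : qob Q Y) (w : word Q Y (sumn qs) A A') :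
  (mu th c : Cbox _ _ _ _) X Y (ncat s1 s2) f A A' w =
  \sum_a \sum_(b | dcat a b == f)
    tens_sum c s2 b A A' (eval th s1 a (star s2 A) (star (face b s2) A') _ _) (raw w).
Proof. by rewrite /= /mu_val /sgt /sle ncat_split. Qed.

Lemma face_dcat r pn p p0 (a : Dinj r p) (b : Dinj pn p0) X W Y
    (s1 : simplex U p X W) (s2 : simplex U p0 W Y) :
  face (dcat a b) (ncat s1 s2) = ncat (face a s1) (face b s2).
Proof.
rewrite -(face_trunc (dcat_mid a b)) ncat_split /=.
by have [-> ->] := dcat_inj (dcat_trunc (dcat_mid a b)).
Qed.

Section Associativity.
Variable (X : U) (M : lmodType k).
Implicit Types (W Y : U) (F : seq (arrow Q X) -> M).

(** A composition occurring as an entry of a list, under a multilinear F, may be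
    expanded into its elementary terms. *)
Lemma mu_cons p r p0 qs pn (th : Cbox Q p (size qs) r) (c : chain (Cmod Q) p0 qs pn)
    W Y (s1 : simplex U p X W) (s2 : simplex U p0 W Y) (f : Dinj (r + pn) (p + p0))
    (A A' : qob Q Y) (w : word Q Y (sumn qs) A A') F l :
  list_multilinear F ->
  F (Arrow ((mu th c : Cbox _ _ _ _) X Y (ncat s1 s2) f A A' w) :: l) =
  \sum_a \sum_(b | dcat a b == f) \sum_(v <- tens c s2 b w)
     F (Arrow (th X W s1 a (star s2 A) (star (face b s2) A') v) :: l).
Proof.
move=> FP; pose h (B B' : qob Q X) (x : qarr B B') := F (Arrow x :: l).
have hl B B' : linear (@h B B') by exact: (FP [::]).
rewrite -[LHS]/(h _ _ _) mu_ncat linear_big //; apply: eq_bigr => a _.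
rewrite linear_big //; apply: eq_bigr => b /eqP e.
rewrite tens_sum_raw linear_big //; apply: eq_bigr => v _.
by rewrite /h eval_raw fit_id // -?star_ncat // -e face_dcat.
Qed.

(** Tensoring the compositions mu(x_i; ...) amounts to tensoring all the inner
    entries, then the x_i. A factor g of f that is not a concatenation
    contributes zero, since the composition at g vanishes and F is multilinear; the
    remaining factorizations of f are those of its two pieces. *)
Lemma tens_sum_dmap p0 p0' qss pn pn' (d : dchain (Cmod Q) p0 p0' qss pn pn')
    W Y (s1 : simplex U p0 X W) (s2 : simplex U p0' W Y)
    (f : Dinj (pn + pn') (p0 + p0')) (A A' : qob Q Y) F
    (w : word Q Y (sumn (map sumn qss)) A A') :
  list_multilinear F ->
  tens_sum (dmap mu d) (ncat s1 s2) f A A' F (raw w) =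
  \sum_a \sum_(b | dcat a b == f)
    tens_sum (inner d) s2 b A A'
      (tens_sum (outer d) s1 a (star s2 A) (star (face b s2) A') F) (raw w).
Proof.
elim: d W s1 s2 f A F w => {p0 p0' qss pn pn'} [p p'|p0 p0' qs p1 p1' qss pn pn' x c d IH]
    W s1 s2 f A F w FP.
  rewrite raw0 tens_sum_nil ?(npath0_eq w) //.
  have -> : f = dcat (did p) (did p') by exact: dinj_uniq.
  by rewrite (sum_dcat _ erefl) !tens_sum_nil ?face_id.
rewrite -(split_ncat (w : word Q Y (sumn qs + sumn (map sumn qss)) A A')).
case: (Defs.split _) => A1 w1 w2 {w} /=.
rewrite raw_ncat tens_sum_cons sum_dcat_all; last first.
  move=> g gp; apply: big1 => h _; apply: tens_sum0 => l.
  by rewrite mu_cons // sum_dcat0.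
(* Expand the head mu(x; c), then apply the induction hypothesis to the tail. *)
transitivity (\sum_a \sum_b \sum_(h | dcomp (dcat a b) h == f)
  \sum_a' \sum_(b' | dcat a' b' == h)
  \sum_(v <- tens c s2 b w1) tens_sum (inner d) (face b s2) b' A1 A'
    (tens_sum (outer d) (face a s1) a' (star (face b s2) A1) (star (face b' (face b s2)) A')
      (fun l => F (Arrow (x _ _ s1 a _ _ v) :: l))) (raw w2)).
  apply: eq_bigr => a _; apply: eq_bigr => b _; apply: eq_bigr => h _.
  under eq_tens_sum do rewrite mu_cons // (sum_dcat _ erefl).
  rewrite face_dcat tens_sum_sum.
  under eq_bigr => v _ do rewrite (IH _ _ _ _ _ _ _ (list_multilinear_cons _ FP)).
  rewrite exchange_big; apply: eq_bigr => a' _ /=; exact: exchange_big.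
rewrite (sum_dcat_comp f (fun a b a' b' =>
  \sum_(v <- tens c s2 b w1) tens_sum (inner d) (face b s2) b' A1 A'
    (tens_sum (outer d) (face a s1) a' (star (face b s2) A1) (star (face b' (face b s2)) A')
      (fun l => F (Arrow (x _ _ s1 a _ _ v) :: l))) (raw w2))).
apply: eq_bigr => aa _; apply: eq_bigr => bb _.
rewrite tens_sum_ccat; apply: eq_bigr => b _; apply: eq_bigr => b'.
rewrite -is_dcomp_eq => e.
rewrite tens_sum_raw -(face_comp s2 e).
under eq_bigr => a _ do rewrite exchange_big.
rewrite exchange_big; apply: eq_bigr => v _ /=.
under [RHS]eq_tens_sum do rewrite tens_sum_cons.
rewrite tens_sum_sum; apply: eq_bigr => a _; by rewrite tens_sum_sum.
Qed.

End Associativity.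

(** * Associativity *)

(** Seen through [eval], the casts of arities in the axioms only replace s and f by
    a simplex and an injection with the same arrows and values. *)
Lemma eval_bcast p p' q q' r r' (ep : p = p') (eq : q = q') (er : r = r') (th : Cbox Q p q r)
    X Y (s : simplex U p X Y) (s' : simplex U p' X Y) (f : Dinj r p) (f' : Dinj r' p')
    A A' B B' l :
  pk s = pk s' -> (forall i, (i <= r)%N -> f # i = f' # i) ->
  eval (bcast ep eq er (th : Cmod Q p q r) : Cbox Q p' q' r') s' f' A A' B B' l =
  eval th s f A A' B B' l.
Proof.
by subst p' q' r' => es ff'; rewrite (pk_inj es) (dinj_ext ff').
Qed.

Lemma eval_mu p r p0 qs pn (th : Cbox Q p (size qs) r) (c : chain (Cmod Q) p0 qs pn)
    X W Y (s1 : simplex U p X W) (s2 : simplex U p0 W Y)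
    (f : Dinj (r + pn) (p + p0)) (A A' : qob Q Y) B B' l :
  star (ncat s1 s2) A = B -> star (face f (ncat s1 s2)) A' = B' ->
  eval (mu th c : Cbox _ _ _ _) (ncat s1 s2) f A A' B B' l =
  \sum_a \sum_(b | dcat a b == f)
    tens_sum c s2 b A A' (eval th s1 a (star s2 A) (star (face b s2) A') B B') l.
Proof.
move=> <- <-; under [RHS]eq_bigr do rewrite -word_ext_sum.
rewrite -word_ext_sum; apply: eq_word_ext => w; rewrite fitE mu_ncat.
by apply: eq_bigr => a _; apply: eq_bigr => b _; rewrite tens_sum_raw.
Qed.

Lemma star_face_pk p p' r r' X Y (s : simplex U p X Y) (s' : simplex U p' X Y)
    (f : Dinj r p) (f' : Dinj r' p') (A : qob Q Y) :
  r = r' -> pk s = pk s' -> (forall i, (i <= r)%N -> f # i = f' # i) ->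
  star s A = star s' A /\ star (face f s) A = star (face f' s') A.
Proof.
move=> er es ff'; have ep : p = p' := congr1 (fun z => projT1 z) es.
by subst p' r'; rewrite (pk_inj es) (dinj_ext ff').
Qed.

(** By [tens_sum_dmap], both sides are sums over the ways of cutting f in three
    consecutive pieces, with equal terms. *)
Lemma muA p r p0 p0' qss pn pn' (x : Cmod Q p (size qss) r)
    (d : dchain (Cmod Q) p0 p0' qss pn pn') :
  mu (bcast erefl (esym (size_map sumn qss)) erefl x) (dmap mu d) =
  bcast (esym (addnA p p0 p0')) (sumn_flatten qss) (esym (addnA r pn pn'))
    (mu (bcast erefl (esym (size_flatten qss)) erefl
            (mu (bcast erefl (esym (size_map size qss)) erefl x) (outer d)))
         (inner d)).
Proof.
apply: cbox_eqP => X Y s f A A' w; rewrite -[LHS]fitE -[RHS]fitE -!eval_raw.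
move eB : (star s A) => B; move eB' : (star (face f s) A') => B'.
move: eB eB'; rewrite -(split_ncat s); case: (Defs.split s) => W s1 t {s}.
rewrite -(split_ncat t) [npre _]/=; case: (Defs.split t) => V s2 s3 {t}.
rewrite [npre _]/= [npost _]/= => eB eB'.
have [f' ff'] : exists f' : Dinj (r + pn + pn') (p + p0 + p0'),
    forall i, (i <= r + (pn + pn'))%N -> f # i = f' # i.
  by move: (addnA r pn pn') (addnA p p0 p0') => e e'; case: _ / e; case: _ / e'; exists f.
have ss := pk_ncatA s1 s2 s3.
have [e1 _] := star_face_pk A (addnA r pn pn') (esym ss) ff'.
have [_ e3] := star_face_pk A' (addnA r pn pn') (esym ss) ff'.
rewrite [RHS](@eval_bcast _ _ _ _ _ _ _ _ _ _ _ _ (ncat (ncat s1 s2) s3) _ f') //; last first.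
  by move=> i ir; rewrite ff' // addnA.
rewrite eval_mu // [RHS]eval_mu; first last.
- by rewrite -e3.
- by rewrite -e1.
(* The common term: a, b and b' are the pieces of f at which x, the x_i and
   the inner entries are evaluated. *)
pose G a b b' := tens_sum (inner d) s3 b' A A'
  (tens_sum (outer d) s2 b (star s3 A) (star (face b' s3) A')
    (eval (x : Cbox _ _ _ _) s1 a (star s2 (star s3 A))
      (star (face b s2) (star (face b' s3) A')) B B'))
  (raw w).
transitivity (\sum_a \sum_(bc | dcat a bc == f) \sum_b \sum_(c | dcat b c == bc) G a b c).
  apply: eq_bigr => a _; apply: eq_bigr => bc _.
  rewrite tens_sum_dmap; last exact: list_multilinear_eval.
  apply: eq_bigr => b _; apply: eq_bigr => c /eqP <-.
  apply: eq_tens_sum => y; apply: eq_tens_sum => z.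
  by rewrite star_ncat face_dcat star_ncat; exact: eval_bcast.
rewrite (sum_dcatA _ ff'); apply: eq_bigr => ab _; apply: eq_bigr => c /eqP e.
symmetry; transitivity (tens_sum (inner d) s3 c A A' (fun y => \sum_a \sum_(b | dcat a b == ab)
  (tens_sum (outer d) s2 b (star s3 A) (star (face c s3) A')
    (eval (x : Cbox _ _ _ _) s1 a (star s2 (star s3 A))
      (star (face b s2) (star (face c s3) A')) B B')) y)
  (raw w)).
  apply: eq_tens_sum => y.
  rewrite (@eval_bcast _ _ _ _ _ _ _ _ _ _ _ _ (ncat s1 s2) _ ab) // eval_mu.
  - apply: eq_bigr => a _; apply: eq_bigr => b _; apply: eq_tens_sum => z; exact: eval_bcast.
  - by rewrite -star_ncat -e1.
  - by rewrite -star_ncat -face_dcat e -e3.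
by rewrite tens_sum_sum; apply: eq_bigr => a _; rewrite tens_sum_sum.
Qed.

(** * Unit laws *)

(** The ends of a 0-simplex are equal only up to a proof, so the identity in
    degree (0, 1, 0) has to move arrows over Y to arrows over X. *)
Definition transport X Y (e : X = Y) (z : arrow Q Y) : arrow Q X :=
  eq_rect Y (arrow Q) z X (esym e).

Definition id_val X Y (s : simplex U 0 X Y) (f : Dinj 0 0) (A A' : qob Q Y)
    (w : word Q Y 1 A A') : qarr (star s A) (star (face f s) A') :=
  fit _ _ (transport (npath0_eq s) (head (Arrow (0 : qarr A A')) (raw w))).

Lemma word_multilinear_id X Y (s : simplex U 0 X Y) (f : Dinj 0 0) (A A' : qob Q Y) :
  word_multilinear (@id_val X Y s f A A').
Proof.
move=> A1; split=> [w|//]; rewrite /id_val /=.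
move: (star s A) (star (face f s) A') (npath0_eq s) => B B' e {s}.
by case: Y / e A A' A1 w => A A' A1 w; exact: fit_linear.
Qed.

Definition id_box : Cbox Q 0 1 0 := MkCbox word_multilinear_id.

Lemma id_boxE X (f : Dinj 0 0) (A A' : qob Q X) (a : qarr A A') (w : word Q X 1 A A') :
  raw w = [:: Arrow a] -> Arrow (id_box X X (pnil X) f A A' w) = Arrow a.
Proof.
move=> wa; rewrite /= /id_val wa /transport (Prop_irrelevance (npath0_eq _) erefl) /=.
by rewrite fit_id ?face_id.
Qed.

Definition unit_box (c : k^o) : Cmod Q 0 1 0 := c *: (id_box : Cmod Q 0 1 0).

Lemma unit_box_linear : linear unit_box.
Proof. by move=> c a b; rewrite /unit_box scalerDl scalerA. Qed.

HB.instance Definition _ :=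
  GRing.isLinear.Build k k^o (Cmod Q 0 1 0) *:%R unit_box unit_box_linear.

Lemma unit_box1 : unit_box 1 = id_box.
Proof. exact: scale1r. Qed.

Lemma tens_sum_units n Y (f : Dinj 0 0) (A A' : qob Q Y) (M : lmodType k)
    (F : seq (arrow Q Y) -> M) (w : word Q Y (sumn (nseq n 1%N)) A A') :
  tens_sum (units (id_box : Cmod Q 0 1 0) n) (pnil Y) f A A' F (raw w) = F (raw w).
Proof.
elim: n A F w => [|n IH] A F w; first by rewrite raw0 tens_sum_nil // (npath0_eq w).
rewrite -(split_ncat (w : word Q Y (1 + sumn (nseq n 1%N)) A A')).
case: (Defs.split _) => A1 w1 w2 {w} /=; rewrite raw_ncat tens_sum_cons.
rewrite sum_dcomp_idl; have [a wa] := word1 w1.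
by rewrite (id_boxE _ wa) face_id IH wa.
Qed.

Lemma mu_1r p n r (x : Cmod Q p n r) :
  bcast (addn0 p) (sumn_nseq1 n) (addn0 r)
    (mu (bcast erefl (size_nseq1 n) erefl x) (units (unit_box 1) n)) = x.
Proof.
rewrite unit_box1; apply: cbox_eqP => X Y s f A A' w; rewrite -[LHS]fitE -[RHS]fitE -!eval_raw.
rewrite (@eval_bcast _ _ _ _ _ _ _ _ _ _ _ _ (ncat s (pnil Y)) _ (dcat f (did 0))); first last.
- by move=> i ir; rewrite dcatl // -(addn0 r).
- exact: ncat_pnil_r.
rewrite eval_mu; first last.
- by rewrite face_dcat star_ncat face_id.
- by rewrite star_ncat.
rewrite (sum_dcat _ erefl) -(raw_ncast (esym (sumn_nseq1 n))) tens_sum_units raw_ncast face_id.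
exact: eval_bcast.
Qed.

(** The cut of f is at 0, so the first piece of f and of the simplex is trivial,
    and the identity is applied to the value of x. *)
Lemma mu_1l p q r (x : Cmod Q p q r) :
  bcast (add0n p) (addn0 q) (add0n r)
    (@mu 0 0 p [:: q] r (unit_box 1) (ccons x (cnil _ r))) = x.
Proof.
rewrite unit_box1; apply: cbox_eqP => X Y s f A A' w; rewrite -[LHS]fitE -[RHS]fitE -!eval_raw.
rewrite (@eval_bcast _ _ _ _ _ _ _ _ _ _ _ _ (ncat (pnil X) s) _ (dcat (did 0) f)) //; last first.
  exact: (dcatr (did 0) f).
rewrite (@eval_mu 0 0 p [:: q] r id_box (ccons x (cnil _ r)) X X Y (pnil X) s) //; last first.
  by rewrite face_dcat star_ncat face_id.
rewrite (sum_dcat _ erefl) -[raw w]cats0 tens_sum_cons sum_dcomp_idr.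
rewrite tens_sum_nil // cats0 eval_raw.
set a := cbox _ _ _ _.
rewrite [LHS](@eval_raw 0 1 0 id_box X X (pnil X) (did 0) _ _ _ _ (pcons a (pnil _))).
by rewrite (id_boxE (w := pcons a (pnil _)) _ erefl).
Qed.

(** * Multilinearity and the box operad *)

Lemma chain_multilinear_sum I (t : seq I) (P : pred I) (M : lmodType k) qs p0 pn
    (G : I -> chain (Cmod Q) p0 qs pn -> M) :
  (forall i, chain_multilinear (G i)) ->
  chain_multilinear (fun c => \sum_(i <- t | P i) G i c).
Proof.
elim: qs p0 G => // q qs IH p0 G GP p1; split=> [c a x y|x]; last first.
  by apply: (IH _ (fun i c => G i (ccons x c))) => i; have [_] := GP i p1; apply.
rewrite scaler_sumr -big_split; apply: eq_bigr => i _.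
by have [+ _] := GP i p1; apply.
Qed.

Lemma chain_multilinear_tens_sum (M : lmodType k) p0 qs pn X Y (s : simplex U p0 X Y)
    (f : Dinj pn p0) (A A' : qob Q Y) (F : seq (arrow Q X) -> M)
    (w : word Q Y (sumn qs) A A') :
  list_multilinear F ->
  chain_multilinear (fun c : chain (Cmod Q) p0 qs pn => tens_sum c s f A A' F (raw w)).
Proof.
elim: qs p0 s f A F w => // q qs IH p0 s f A F w FP p1.
rewrite -(split_ncat (w : word Q Y (q + sumn qs) A A')).
case: (Defs.split _) => A1 w1 w2 {w}; rewrite [npre _]/= [npost _]/= raw_ncat.
split=> [c a x y|x].
  rewrite !tens_sum_cons scaler_sumr -big_split; apply: eq_bigr => g _ /=.
  rewrite scaler_sumr -big_split; apply: eq_bigr => h _ /=.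
  rewrite !tens_sum_raw scaler_sumr -big_split; apply: eq_bigr => v _ /=.
  exact: (FP [::]).
under eq_fun do rewrite tens_sum_cons.
apply: chain_multilinear_sum => g; apply: chain_multilinear_sum => h.
exact: (IH _ _ _ _ (fun l => F (_ :: l)) _ (list_multilinear_cons _ FP)).
Qed.

Lemma chain_multilinear_cbox p q r qs p0 pn (G : chain (Cmod Q) p0 qs pn -> Cbox Q p q r) :
  (forall X Y s f A A' w, chain_multilinear (fun c => G c X Y s f A A' w)) ->
  chain_multilinear (G : _ -> Cmod Q p q r).
Proof.
elim: qs p0 G => // q' qs IH p0 G GP p1; split=> [c a x y|x].
  apply: cbox_eqP => X Y s f A A' w; have [+ _] := GP X Y s f A A' w p1; exact.
apply: (IH _ (fun c => G (ccons x c))) => X Y s f A A' w.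
by have [_] := GP X Y s f A A' w p1; apply.
Qed.

Lemma mu_multilinear p r p0 qs pn (x : Cmod Q p (size qs) r) :
  chain_multilinear (fun c : chain (Cmod Q) p0 qs pn => mu x c : Cmod Q _ _ _).
Proof.
apply: chain_multilinear_cbox => X Y s f A A' w.
apply: chain_multilinear_sum => a; apply: chain_multilinear_sum => b.
exact/chain_multilinear_tens_sum/list_multilinear_eval.
Qed.

Lemma mu_linear p r p0 qs pn (c : chain (Cmod Q) p0 qs pn) :
  linear (fun x : Cmod Q p (size qs) r => mu x c : Cmod Q _ _ _).
Proof.
move=> t x y; apply: cbox_eqP => X Y s f A A' w /=; rewrite /mu_val.
rewrite scaler_sumr -big_split; apply: eq_bigr => a _ /=.
rewrite scaler_sumr -big_split; apply: eq_bigr => b _ /=.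
rewrite !tens_sum_raw scaler_sumr -big_split; apply: eq_bigr => v _ /=.
by rewrite !eval_raw; exact: fit_linear.
Qed.

Definition cbox_operad : boxOperad (Cmod Q) :=
  BoxOperad (bunit := unit_box) mu_linear mu_multilinear muA mu_1r mu_1l.

End Composition.

Theorem proposition4p5 (k : comPzRingType) (U : smallCat) (Q : quiver k U) :
  exists O : boxOperad (Cmod Q),
    (forall (p r p0 pn : nat) (qs : seq nat)
        (th : Cbox Q p (size qs) r) (ths : chain (Cmod Q) p0 qs pn)
        (X Y : U) (s : simplex U (p + p0) X Y) (f : Dinj (r + pn) (p + p0))
        (A A' : qob Q Y) (w : word Q Y (sumn qs) A A'),
      (forall e : f # r = p,
        (bmu O th ths : Cbox Q _ _ _) X Y s f A A' w =
        acast (star_trunc s A) (star_face_trunc s e A')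
          (\sum_(v <- tens ths (sgt s) (dgt e) w) th _ _ (sle s) (dle e) _ _ v)) /\
      (f # r <> p -> (bmu O th ths : Cbox Q _ _ _) X Y s f A A' w = 0)) /\
    (forall (X : U) (f : Dinj 0 0) (A A' : qob Q X) (a : qarr A A'),
      (bunit O 1 : Cbox Q 0 1 0) X X (pnil X) f A A' (pcons a (pnil A')) =
      acast erefl (star_face_id f (pnil X) A') a).
Proof.
exists (cbox_operad Q); split=> [p r p0 pn qs th ths X Y s f A A' w|X f A A' a].
  split=> [e|fr] /=; last exact: sum_dcat0.
  rewrite /mu_val (sum_dcat _ (dcat_trunc e)) tens_sum_raw fit_acast.
  rewrite (linear_big _ _ _ (@fit_linear _ _ _ _ _ _ _ _)).
  by apply: eq_bigr => v _; rewrite eval_raw.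
have -> : bunit (cbox_operad Q) 1 = id_box Q by exact: unit_box1.
by rewrite fit_acast -[LHS]fitE (id_boxE (w := pcons a (pnil _)) _ erefl).
Qed.
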